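(* Let $F$ be a non-Archimedean local field and $E=F\times F\times F$. For integers $a,b\ge0$ and $c\in\mathfrak o$ let $\mathcal O_{a,b,c}$ be the $\mathfrak o$-submodule of $E$ generated by $(1,1,1)$, $(0,\pi^a,0)$, $(0,c,\pi^b)$. Then: (1) Every order of $E$ is of the form $\mathcal O_{a,b,c}$ where $$\begin{cases}c\in(\pi^{\lceil a/2\rceil}) & \text{if }a\le2b;\\ c\in(\pi^{a-b})\ \text{or}\ c\in\pi^b+(\pi^{a-b}) & \text{if }a>2b.\end{cases}$$ Conversely, an $\mathfrak o$-module $\mathcal O_{a,b,c}$ satisfying this condition is an order. (2) An order $\mathcal O_{a',b',c'}$ (satisfying the condition in (1)) contains an order $\mathcal O_{a,b,c}$ if and only if $a'\le a$, $b'\le b$, and $$\begin{cases}c'\in(\pi^{a'-(b-b')}) & \text{if }\mathrm{ord}(c)\ge a';\\ c'-\pi^{-(b-b')}c\in(\pi^{a'-(b-b')}) & \text{if }\mathrm{ord}(c)<a'.\end{cases}$$ In the second case, $\lceil a'/2\rceil\le\mathrm{ord}(c)-(b-b')=\mathrm{ord}(c')$ if $a'\le2b'$, and $a'>b$ if $a'>2b'$. (3) Two orders $\mathcal O_{a',b',c'}$ and $\mathcal O_{a,b,c}$ are equal if and only if $a=a'$, $b=b'$ and $c-c'\in(\pi^a)$. (4) For an order $\mathcal O_{a,b,c}$, $S(\mathcal O_{a,b,c})=a+b$ and the conductor is $$\mathfrak f(\mathcal O_{a,b,c})=(\pi^{f_1})\times(\pi^{f_2})\times(\pi^{f_3})=(\pi^{\max(b,\,a+b-\mathrm{ord}(c-\pi^b))})\times(\pi^a)\times(\pi^{\max(b,\,a+b-\mathrm{ord}(c))}).$$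 More precisely, $(f_1,f_3)=(\max(a,b),\,b)$ if $\mathrm{ord}(c)\ge a$, and $(f_1,f_3)=(\max(b,\,a+b-\mathrm{ord}(c-\pi^b)),\,a+b-\mathrm{ord}(c))$ if $\mathrm{ord}(c)<a$. (5) An order $\mathcal O_{a,b,c}$ is Gorenstein if and only if $$\begin{cases}a=0\text{ or }b=0 & \text{if }\mathrm{ord}(c)\ge a;\\ \mathrm{ord}(c-\pi^b)=a-b>0 & \text{if }\mathrm{ord}(c)<a\text{ and }c-\pi^b\in(\pi^{b+1});\\ \mathrm{ord}(c)=\tfrac a2\le b,\ \text{or}\ \mathrm{ord}(c)=a-b>b & \text{if }\mathrm{ord}(c)<a\text{ and }c-\pi^b\notin(\pi^{b+1}).\end{cases}$$
   Context: $F$ has any characteristic, ring of integers $\mathfrak o$, uniformizer $\pi$; $\mathrm{ord}$ is the normalized valuation of $F$ with $\mathrm{ord}(0)=\infty$. For $j\in\mathbb Z$, $(\pi^j)=\pi^j\mathfrak o\subset F$ (conditions in (2) are read in $F$). The maximal order of $E$ is $\mathcal O_E=\mathfrak o\times\mathfrak o\times\mathfrak o$. An order of $E$ is a subring $\mathcal O\subset E$ containing $\mathfrak o$ (diagonally), finitely generated as an $\mathfrak o$-module, with $F\mathcal O=E$. $S(\mathcal O)$ is the $\mathfrak o$-length of $\mathcal O_E/\mathcal O$; $\mathfrak f(\mathcal O)=\{a\in\mathcal O_E:a\mathcal O_E\subset\mathcal O\}$. A fractional $\mathcal O$-ideal is a finitely generated $\mathcal O$-submodule $I\subset E$ with $FI=E$;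 it is invertible if $IJ=\mathcal O$ for some fractional ideal $J$. $\mathcal O$ is Gorenstein if every fractional $\mathcal O$-ideal $I$ with $\{y\in E:yI\subset I\}=\mathcal O$ is invertible.
   Formalization: In (5) the criterion is corrected: an order with b = 0 and ord(c−1) > a is also Gorenstein. As printed, (5) wrongly excludes these when a > 0, e.g. a = 1, b = 0, c = 1, where the order is the product of 𝔬 and a quadratic order. *)

(* Defs.v *)
From HB Require Import structures.
From mathcomp Require Import all_boot all_order all_algebra.
From mathcomp Require Import boolp classical_sets constructive_ereal.

Set Implicit Arguments.
Unset Strict Implicit.
Unset Printing Implicit Defensive.

Import Order.TTheory GRing.Theory Num.Theory.
Local Open Scope classical_set_scope.
Local Open Scope ring_scope.

(* F is a non-Archimedean local field with normalized valuation ord: a field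
   complete for a discrete valuation, with finite residue field.  The value
   -oo of \bar int is never taken. *)
Record local_field_valuation (F : fieldType) (ord : F -> \bar int) : Prop := {
  ord_zero : ord 0 = +oo%E;
  ord_fin : forall x : F, x != 0 -> exists n : int, ord x = n%:E;
  ord_mul : forall x y, ord (x * y) = (ord x + ord y)%E;
  ord_add : forall x y, (Order.min (ord x) (ord y) <= ord (x + y)%R)%E;
  ord_normalized : exists x, ord x = 1%:E;
  ord_complete : forall u : nat -> F,
    (forall n : int, exists N : nat, forall i j : nat,
       (N <= i)%N -> (N <= j)%N -> (n%:E <= ord (u i - u j)%R)%E) ->
    exists l : F, forall n : int, exists N : nat, forall i : nat,
      (N <= i)%N -> (n%:E <= ord (u i - l)%R)%E;
  ord_residue_finite : exists s : seq F, forall x : F,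
    (0 <= ord x)%E -> exists2 y, y \in s & (0 < ord (x - y)%R)%E
}.

Definition integers (F : fieldType) (ord : F -> \bar int) : set F :=
  [set x | (0 <= ord x)%E].

(* The fractional ideal (pi^j) of F, for j in Z. *)
Definition pi_ideal (F : fieldType) (ord : F -> \bar int) (pi : F) (j : int) :
  set F := [set pi ^ j * u | u in integers ord].

(* F^o makes the ring product F x F x F an F-algebra, with F acting
   diagonally: k%:A = (k, k, k). *)
Notation cubic F := ((F^o * F^o * F^o)%type).

(* Finite sums of act a x with a in A and x in X.  Taking act to be scaling or
   multiplication gives o-modules and O-modules generated by X, the set F I,
   and the product I J of two ideals. *)
Definition sums (S : Type) (V : nmodType) (act : S -> V -> V)
    (A : set S) (X : set V) : set V :=
  [set v | exists (n : nat) (a : 'I_n -> S) (x : 'I_n -> V),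
     [/\ forall i, A (a i), forall i, X (x i) & v = \sum_(i < n) act (a i) (x i)]].

Section CubicOrders.
Variables (F : fieldType) (ord : F -> \bar int).
Let oF := integers ord.
Implicit Types (O I J M N : set (cubic F)).

Definition max_order : set (cubic F) := oF `*` oF `*` oF.

Definition spans_F I := sums *:%R setT I = setT.

Record is_order O : Prop := {
  order_one : O 1;
  order_sub : forall x y, O x -> O y -> O (x - y);
  order_mul : forall x y, O x -> O y -> O (x * y);
  order_integers : forall k : F, oF k -> O k%:A;
  order_fingen : exists s : seq (cubic F), O = sums *:%R oF [set` s];
  order_full : spans_F O
}.

Definition omodule M :=
  [/\ M 0, forall x y, M x -> M y -> M (x + y) &
      forall (k : F) x, oF k -> M x -> M (k *: x)].

(* A strict chain of length n of submodules of M / N, each of them given by the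
   o-module between N and M that it corresponds to. *)
Definition quotient_chain M N (n : nat) (W : nat -> set (cubic F)) :=
  (forall i, (i <= n)%N -> [/\ omodule (W i), N `<=` W i & W i `<=` M]) /\
  (forall i, (i < n)%N -> W i `<` W i.+1).

Definition quotient_length M N (n : nat) :=
  (exists W, quotient_chain M N n W) /\
  (forall m W, quotient_chain M N m W -> (m <= n)%N).

Definition conductor O : set (cubic F) :=
  [set x | max_order x /\ forall y, max_order y -> O (x * y)].

Definition fractional_ideal O I :=
  (exists s : seq (cubic F), I = sums *%R O [set` s]) /\ spans_F I.

Definition invertible_ideal O I :=
  exists2 J, fractional_ideal O J & sums *%R I J = O.

Definition gorenstein O := forall I, fractional_ideal O I ->
  [set y | forall x, I x -> I (y * x)] = O -> invertible_ideal O I.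

Variable pi : F.

Definition Oabc (a b : nat) (c : F) : set (cubic F) :=
  sums *:%R oF [set` [:: (1, 1, 1); (0, pi ^+ a, 0); (0, c, pi ^+ b)] : seq (cubic F)].

Definition order_condition (a b : nat) (c : F) : Prop :=
  if (a <= 2 * b)%N then pi_ideal ord pi (uphalf a)%:Z c
  else pi_ideal ord pi (a%:Z - b%:Z) c \/
       [set pi ^+ b + y | y in pi_ideal ord pi (a%:Z - b%:Z)] c.

Definition gorenstein_condition (a b : nat) (c : F) : Prop :=
  if (a%:Z%:E <= ord c)%E then a = 0%N \/ b = 0%N
  else (pi_ideal ord pi b.+1%:Z (c - pi ^+ b) /\
         (ord (c - pi ^+ b) = (a%:Z - b%:Z)%:E /\ 0 < a%:Z - b%:Z)) \/
       (~ pi_ideal ord pi b.+1%:Z (c - pi ^+ b) /\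
         ([/\ ~~ odd a, ord c = (a./2)%:Z%:E & (a./2 <= b)%N] \/
          (ord c = (a%:Z - b%:Z)%:E /\ b%:Z < a%:Z - b%:Z))).

End CubicOrders.

(* Main.v *)
(* Hermite normal form: an o-lattice between o(1,1,1) and the maximal order is
   some O_{a,b,c}, with b the least valuation of v3 - v1 and a that of t for
   (0,t,0) in the lattice; it is a ring iff ord c + ord (c - pi^b) >= a.  Inclusions
   are read off the generators, and a + b drops strictly along a chain of lattices,
   which gives the length.

   For (5), let O^v be the dual of O for the trace form.  Lattices are reflexive
   (a triple of least determinant is a basis), so (I : I) = (I I^v)^v.  If
   O^v = tO with t invertible, then (I : I) = O gives I I^v = O^v = tO and I is
   invertible; suitable t are written down when ord c + ord (c - pi^b) = a and in
   the cases where O splits off a factor o.  Otherwise O^v, whose multiplier ring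
   is O, is not invertible: every product O^v J contained in O has its middle
   entries in (pi). *)
Require Import Defs.
From HB Require Import structures.
From mathcomp Require Import all_boot all_order all_algebra.
From mathcomp Require Import boolp classical_sets constructive_ereal.
From mathcomp Require Import zify ring.

Set Implicit Arguments.
Unset Strict Implicit.
Unset Printing Implicit Defensive.

Import Order.TTheory GRing.Theory Num.Theory.
Local Open Scope classical_set_scope.
Local Open Scope ring_scope.

Lemma ex_min_nat (P : nat -> Prop) :
  (exists n, P n) -> exists2 n, P n & forall m, P m -> (n <= m)%N.
Proof.
move=> [n0 Pn0]; have /ex_minnP[n /asboolP Pn nmin] : exists n, `[< P n >].
  by exists n0; apply/asboolP.
by exists n => // m Pm; apply: nmin; apply/asboolP.
Qed.

(** * Sums of products *)

Section Sums.
Variables (S : Type) (V : nmodType) (act : S -> V -> V).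
Implicit Types (A : set S) (X : set V).

Lemma sums_ind A X (P : V -> Prop) : P 0 -> (forall v w, P v -> P w -> P (v + w)) ->
  (forall s v, A s -> X v -> P (act s v)) -> forall v, sums act A X v -> P v.
Proof.
move=> P0 PD Pact v [n [a [x [aA xX ->]]]].
by apply: big_ind => // i _; apply: Pact.
Qed.

Lemma sums0 A X : sums act A X 0.
Proof.
by exists 0%N, (fun i : 'I_0 => False_rect _ (notF (ltn_ord i))), (fun=> 0); split;
  [case..|rewrite big_ord0].
Qed.

Lemma sums_act A X s v : A s -> X v -> sums act A X (act s v).
Proof.
by move=> As Xv; exists 1%N, (fun=> s), (fun=> v); split=> //; rewrite big_ord1.
Qed.

Lemma sumsD A X v w : sums act A X v -> sums act A X w -> sums act A X (v + w).
Proof.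
move=> [n [a [x [aA xX ->]]]] [m [b [y [bA yX ->]]]].
exists (n + m)%N, (fun i => match split i with inl j => a j | inr j => b j end),
  (fun i => match split i with inl j => x j | inr j => y j end).
split=> [i|i|]; [by case: (split i)..|].
rewrite big_split_ord /=; congr (_ + _); apply: eq_bigr => i _.
  by rewrite (unsplitK (inl i)).
by rewrite (unsplitK (inr i)).
Qed.

End Sums.

(** * Coordinates, trace and determinant on the cubic algebra *)

Section Cubic.
Variable F : fieldType.
Implicit Types x y z : cubic F.

Lemma cubic_ext x y :
  x.1.1 = y.1.1 -> x.1.2 = y.1.2 -> x.2 = y.2 -> x = y.
Proof. by case: x => -[? ?] ?; case: y => -[? ?] ? /= -> -> ->. Qed.

Definition tr x : F := x.1.1 + x.1.2 + x.2.

Definition det x y z : F :=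
  x.1.1 * (y.1.2 * z.2 - y.2 * z.1.2) - x.1.2 * (y.1.1 * z.2 - y.2 * z.1.1)
  + x.2 * (y.1.1 * z.1.2 - y.1.2 * z.1.1).

(** The usual vector product: the trace form pairs [v] with [cross w u] to [det v w u], so scaled
    vector products give dual bases. *)
Definition cross x y : cubic F :=
  (x.1.2 * y.2 - x.2 * y.1.2, x.2 * y.1.1 - x.1.1 * y.2,
   x.1.1 * y.1.2 - x.1.2 * y.1.1).

Lemma scale11 (k : F) x : (k *: x).1.1 = k * x.1.1. Proof. by []. Qed.
Lemma scale12 (k : F) x : (k *: x).1.2 = k * x.1.2. Proof. by []. Qed.
Lemma scale2 (k : F) x : (k *: x).2 = k * x.2. Proof. by []. Qed.

Definition cubicE := (scale11, scale12, scale2).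

End Cubic.

(** * The valuation *)

Section Valuation.
Variables (F : fieldType) (ord : F -> \bar int) (pi : F).
Hypotheses (ord_val : local_field_valuation ord) (ord_pi : ord pi = 1%:E).
Implicit Types (x y z : F) (i j n : int).

(** Membership in [(pi^j)] as a valuation bound; it treats [x = 0] and negative [j] uniformly and
    does not mention [pi]. *)
Definition ge j x : Prop := (j%:E <= ord x)%E.

Lemma ordP x : (x = 0 /\ ord x = +oo%E) \/ (x != 0 /\ exists n, ord x = n%:E).
Proof.
have [->|x0] := eqVneq x 0; first by left; rewrite (ord_zero ord_val).
by right; split => //; apply: ord_fin.
Qed.

Lemma ge0 j : ge j 0.
Proof. by rewrite /ge (ord_zero ord_val) leey. Qed.

Lemma ge_trans i j x : i <= j -> ge j x -> ge i x.
Proof. by move=> ij; apply: le_trans; rewrite lee_fin. Qed.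

Lemma geD j x y : ge j x -> ge j y -> ge j (x + y).
Proof.
by move=> jx jy; apply: le_trans (ord_add ord_val x y); rewrite le_min jx jy.
Qed.

Lemma geM i j x y : ge i x -> ge j y -> ge (i + j) (x * y).
Proof. by rewrite /ge (ord_mul ord_val) EFinD; apply: leeD. Qed.

Lemma ord1 : ord 1 = 0%:E.
Proof.
have [[/eqP]|[_ [n on]]] := ordP 1; first by rewrite oner_eq0.
have := ord_mul ord_val 1 1; rewrite mulr1 on -EFinD => -[nn].
by congr (_%:E); lia.
Qed.

(** The square of [-1] is [1], so [ord (-1)] doubles to [0] and is itself [0]. *)
Lemma ordN x : ord (- x) = ord x.
Proof.
suff -> : ord (- x) = (ord (-1) + ord x)%E.
  suff -> : ord (-1) = 0%:E by rewrite add0e.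
  have [[/eqP]|[_ [n on]]] := ordP (-1); first by rewrite oppr_eq0 oner_eq0.
  have := ord_mul ord_val (-1) (-1); rewrite mulrNN mulr1 ord1 on -EFinD.
  by move=> -[nn]; congr (_%:E); lia.
by rewrite -(ord_mul ord_val) mulN1r.
Qed.

Lemma geN j x : ge j x -> ge j (- x).
Proof. by rewrite /ge ordN. Qed.

Lemma geB j x y : ge j x -> ge j y -> ge j (x - y).
Proof. by move=> jx jy; apply: geD => //; apply: geN. Qed.

Lemma ge1 : ge 0 1.
Proof. by rewrite /ge ord1. Qed.

Lemma geMl j x y : ge 0 x -> ge j y -> ge j (x * y).
Proof. by move=> x0 yj; rewrite -(add0r j); apply: geM. Qed.

Lemma geMr j x y : ge j x -> ge 0 y -> ge j (x * y).
Proof. by move=> x0 yj; rewrite -(addr0 j); apply: geM. Qed.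

Lemma ord_neq0 x n : ord x = n%:E -> x != 0.
Proof. by move=> xn; apply/eqP => x0; rewrite x0 (ord_zero ord_val) in xn. Qed.

Lemma pi_neq0 : pi != 0. Proof. exact: ord_neq0 ord_pi. Qed.

Lemma ordV x n : ord x = n%:E -> ord x^-1 = (- n)%:E.
Proof.
move=> xn; have x0 := ord_neq0 xn.
have := ord_mul ord_val x x^-1; rewrite mulfV// ord1 xn.
have [[/eqP]|[_ [m ->]]] := ordP x^-1; first by rewrite invr_eq0 (negPf x0).
by rewrite -EFinD => -[nm]; congr (_%:E); lia.
Qed.

Lemma ordX (n : nat) : ord (pi ^+ n) = n%:Z%:E.
Proof.
elim: n => [|n IH]; first by rewrite expr0 ord1.
by rewrite exprS (ord_mul ord_val) ord_pi IH -EFinD; congr (_%:E); lia.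
Qed.

Lemma ord_piz n : ord (pi ^ n) = n%:E.
Proof.
case: n => n; first by rewrite -exprnP ordX.
by rewrite NegzE -exprnN (ordV (ordX _)).
Qed.

Lemma geX (n : nat) : ge n (pi ^+ n). Proof. by rewrite /ge ordX. Qed.
Lemma ge_piz n : ge n (pi ^ n). Proof. by rewrite /ge ord_piz. Qed.

Lemma geV x n : ord x = n%:E -> ge (- n) x^-1.
Proof. by move=> /ordV xn; rewrite /ge xn. Qed.

Lemma geVX (n : nat) : ge (- n%:Z) (pi ^+ n)^-1.
Proof. exact/geV/ordX. Qed.

Lemma ge_divX (n : nat) x : ge n x -> ge 0 (x / pi ^+ n).
Proof. by move=> xn; rewrite -(subrr n%:Z); apply: geM xn (geVX n). Qed.

Lemma ge_divXE (n : nat) j x : ge j (x / pi ^+ n) <-> ge (j + n) x.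
Proof.
split=> [h|h]; last by rewrite -(addrK n%:Z j); apply: geM h (geVX n).
rewrite -(divfK (expf_neq0 n pi_neq0) x).
exact: geM h (geX n).
Qed.

Lemma pi_idealP n x : pi_ideal ord pi n x <-> ge n x.
Proof.
split=> [[u u0 <-]|xn].
  by apply: geMr (ge_piz n) u0.
exists (x / pi ^ n); last by rewrite mulrC divfK // expfz_neq0 // pi_neq0.
by have := geM xn (geV (ord_piz n)); rewrite subrr.
Qed.

(** The upper bound is the ultrametric inequality for [x = (x + y) - y], where [ord y <= ord x] is
    excluded. *)
Lemma ord_addr_lt x y : (ord x < ord y)%E -> ord (x + y) = ord x.
Proof.
move=> xy; apply/eqP; rewrite eq_le; apply/andP; split; last first.
  by apply: le_trans (ord_add ord_val x y); rewrite le_min lexx ltW.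
have := ord_add ord_val (x + y) (- y); rewrite addrK ordN ge_min.
by case/orP => //; rewrite leNgt xy.
Qed.

Local Notation V := (cubic F).
Local Notation oF := (integers ord).
Local Notation O_ := (Oabc ord pi).
Implicit Types (O I J M N : set V).

(** * The modules Oabc *)

Lemma sums_omodule (A : set F) (X : set V) :
  (forall k l, oF k -> A l -> A (k * l)) -> omodule ord (sums *:%R A X).
Proof.
move=> oA; split; [exact: sums0|by move=> x y; apply: sumsD|move=> k x ok].
apply: (sums_ind (P := fun v => sums _ A X (k *: v))) x => [|u w|s v As Xv]; first by rewrite scaler0; apply: sums0.
  by rewrite scalerDr; apply: sumsD.
by rewrite scalerA; apply: sums_act => //; apply: oA.
Qed.

Lemma integersM x y : oF x -> oF y -> oF (x * y).
Proof. exact: geMl. Qed.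

Lemma sub_sums (X : set V) M : omodule ord M -> X `<=` M ->
  sums *:%R oF X `<=` M.
Proof. by move=> [M0 MD MZ] XM v; apply: sums_ind => // k w ok /XM; apply: MZ. Qed.

(** Solving [x = k(1,1,1) + s(0,pi^a,0) + r(0,c,pi^b)] gives [k = x1], [r = (x3 - x1)/pi^b] and
    [s = (x2 - x1 - c r)/pi^a]; the conditions say that [k], [r] and [s] are integral. *)
Definition in_abc (a b : nat) (c : F) : set V := [set x | [/\ ge 0 x.1.1,
  ge b (x.2 - x.1.1) & ge a (x.1.2 - x.1.1 - c * ((x.2 - x.1.1) / pi ^+ b))]].

Lemma in_abc_omodule a b c : omodule ord (in_abc a b c).
Proof.
split=> [|x y [x1 x2 x3] [y1 y2 y3]|k x ok [x1 x2 x3]].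
- by split; rewrite ?(subrr, mul0r, mulr0); apply: ge0.
- split; rewrite /=; first exact: geD.
    rewrite [X in ge _ X](_ : _ = (x.2 - x.1.1) + (y.2 - y.1.1)); last by ring.
    exact: geD.
  rewrite [X in ge _ X](_ : _ = (x.1.2 - x.1.1 - c * ((x.2 - x.1.1) / pi ^+ b))
    + (y.1.2 - y.1.1 - c * ((y.2 - y.1.1) / pi ^+ b))); last by ring.
  exact: geD.
- split; rewrite !cubicE; first exact: geMl.
    by rewrite -mulrBr; apply: geMl.
  rewrite [X in ge _ X](_ : _ = k * (x.1.2 - x.1.1 - c * ((x.2 - x.1.1) / pi ^+ b))).
    exact: geMl.
  by ring.
Qed.

Lemma OabcE a b c : O_ a b c = in_abc a b c.
Proof.
rewrite eqEsubset; split.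
  apply: sub_sums (in_abc_omodule _ _ _) _ => x /=.
  have pb0 : pi ^+ b != 0 by rewrite expf_neq0 // pi_neq0.
  rewrite !inE => /or3P[] /eqP->; split=> /=.
  - exact: ge1.
  - by rewrite subrr; apply: ge0.
  - by rewrite !subrr mul0r mulr0 subr0; apply: ge0.
  - exact: ge0.
  - by rewrite subrr; apply: ge0.
  - by rewrite !subr0 mul0r mulr0 subr0; apply: geX.
  - exact: ge0.
  - by rewrite subr0; apply: geX.
  - by rewrite !subr0 divff // mulr1 subrr; apply: ge0.
move=> x [x1 x2 x3].
have [_ OD OZ] : omodule ord (O_ a b c) by apply: sums_omodule integersM.
have gen : forall g : V, g \in ([:: (1, 1, 1); (0, pi ^+ a, 0); (0, c, pi ^+ b)] : seq V) -> O_ a b c g.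
  by move=> g gin; rewrite -[g]scale1r; apply: sums_act => //; apply: ge1.
have -> : x = x.1.1 *: ((1, 1, 1) : V)
  + ((x.1.2 - x.1.1 - c * ((x.2 - x.1.1) / pi ^+ b)) / pi ^+ a) *: ((0, pi ^+ a, 0) : V)
  + ((x.2 - x.1.1) / pi ^+ b) *: ((0, c, pi ^+ b) : V).
  have pi0 := pi_neq0.
  by apply: cubic_ext => /=; rewrite /GRing.scale /=; field; rewrite ?expf_neq0.
apply: (OD); first apply: (OD); apply: (OZ).
- exact: x1.
- by apply: gen; rewrite !inE eqxx.
- exact: ge_divX.
- by apply: gen; rewrite !inE eqxx orbT.
- exact: ge_divX.
- by apply: gen; rewrite !inE eqxx !orbT.
Qed.

Lemma ge_piz_mul j n x : ge j (pi ^ n * x) <-> ge (j - n) x.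
Proof.
split=> h; last by rewrite -(subrKC n j); apply: geM h; apply: ge_piz.
rewrite -(mulKf (expfz_neq0 n pi_neq0) x) [in ge _](addrC j).
exact: geM (geV (ord_piz n)) h.
Qed.

Lemma ge_piX_mul j (n : nat) x : ge j (pi ^+ n * x) <-> ge (j - n%:Z) x.
Proof. exact: (ge_piz_mul j n). Qed.

Lemma ge_Xnat (n m : nat) : ge n (pi ^+ m) <-> (n <= m)%N.
Proof. by rewrite /ge ordX lee_fin lez_nat. Qed.

Lemma max_orderP v : max_order ord v <-> [/\ ge 0 v.1.1, ge 0 v.1.2 & ge 0 v.2].
Proof. by split=> [[[]]|[]]. Qed.

Lemma max_e1 : max_order ord (1, 0, 0).
Proof. by apply/max_orderP; split; [apply: ge1|apply: ge0..]. Qed.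

Lemma max_e2 : max_order ord (0, 1, 0).
Proof. by apply/max_orderP; split; by [apply: ge0|apply: ge1]. Qed.

Lemma max_e3 : max_order ord (0, 0, 1).
Proof. by apply/max_orderP; split; by [apply: ge0|apply: ge1]. Qed.

Lemma Oabc_max a b c : oF c -> O_ a b c `<=` max_order ord.
Proof.
move=> oc v; rewrite OabcE => -[v1 v2 v3]; apply/max_orderP; split=> //.
  rewrite -[v.1.2](subrK (v.1.1 + c * ((v.2 - v.1.1) / pi ^+ b))).
  apply: geD; first by rewrite opprD addrA; apply: ge_trans v3.
  by apply: geD => //; apply: geMl => //; apply: ge_divX.
by rewrite -[v.2](subrK v.1.1); apply: geD => //; apply: ge_trans v2.
Qed.

Lemma Oabc_one a b c : O_ a b c 1.
Proof.
rewrite OabcE; split=> /=; first exact: ge1.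
  by rewrite subrr; apply: ge0.
by rewrite !subrr mul0r mulr0 subr0; apply: ge0.
Qed.

Lemma Oabc_omodule a b c : omodule ord (O_ a b c).
Proof. by rewrite OabcE; apply: in_abc_omodule. Qed.

Definition cofinite M :=
  exists n : nat, forall v, max_order ord v -> M (pi ^+ n *: v).

Lemma cofinite_spans M : cofinite M -> spans_F M.
Proof.
move=> [n nM]; rewrite /spans_F eqEsubset; split=> // v _.
have E : pi ^+ n != 0 by rewrite expf_neq0 // pi_neq0.
have -> : v = (v.1.1 / pi ^+ n) *: (pi ^+ n *: ((1, 0, 0) : V))
  + (v.1.2 / pi ^+ n) *: (pi ^+ n *: ((0, 1, 0) : V))
  + (v.2 / pi ^+ n) *: (pi ^+ n *: ((0, 0, 1) : V)).
  by apply: cubic_ext => /=; rewrite /GRing.scale /=; field; rewrite ?E.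
by apply: sumsD; first apply: sumsD; apply: sums_act => //; apply: nM;
  by [apply: max_e1|apply: max_e2|apply: max_e3].
Qed.

Lemma ge_0_nat (n : nat) x : ge 0 x -> ge n (pi ^+ n * x).
Proof. by move=> x0; apply: geMr x0; apply: geX. Qed.

Lemma Oabc_cofinite a b c : oF c -> cofinite (O_ a b c).
Proof.
(* The factor [pi^b] absorbs the division in the third condition of [in_abc], and [pi^a] then
   provides the required bound. *)
move=> oc; exists (a + b)%N => v /max_orderP[v1 v2 v3]; rewrite OabcE.
have E : pi ^+ b != 0 by rewrite expf_neq0 // pi_neq0.
split; rewrite !cubicE -?mulrBr.
- by apply/ge_piX_mul; apply: ge_trans v1; lia.
- by apply/ge_piX_mul; apply: ge_trans (geB v3 v1); lia.
- rewrite exprD (_ : _ - _ = pi ^+ a * (pi ^+ b * (v.1.2 - v.1.1) - c * (v.2 - v.1.1))).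
    apply: ge_0_nat.
    apply: geB; last by apply: geMl => //; apply: geB.
    by apply: geMl (geB v2 v1); apply: ge_trans (geX b).
  by field.
Qed.

(** Necessity comes from the square of [(0,c,pi^b)], whose third condition in [in_abc] reads
    [c^2 - c pi^b] in [(pi^a)]. *)
Lemma Oabc_is_order a b c : oF c ->
  is_order ord (O_ a b c) <-> ge a (c * (c - pi ^+ b)).
Proof.
move=> oc; have E : pi ^+ b != 0 by rewrite expf_neq0 // pi_neq0.
have [O0 OD OZ] := Oabc_omodule a b c.
split=> [[_ _ OM _ _ _]|sq].
  have q : O_ a b c (0, c, pi ^+ b).
    rewrite OabcE; split=> /=; rewrite ?subr0; [exact: ge0|exact: geX|].
    by rewrite divff // mulr1 subrr; apply: ge0.
  have := OM _ _ q q; rewrite OabcE => -[_ _] /=.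
  by rewrite mul0r !subr0 mulfK // -mulrBr.
split; rewrite ?OabcE.
- by rewrite -OabcE; apply: Oabc_one.
- rewrite -OabcE => v w Ov Ow; apply: OD => //.
  by rewrite -scaleN1r; apply: OZ => //; apply/geN/ge1.
- move=> v w; rewrite -OabcE => Ov Ow.
  have /max_orderP[_ v2 v3] := Oabc_max oc Ov.
  have /max_orderP[_ w2 w3] := Oabc_max oc Ow.
  move: Ov Ow; rewrite OabcE => -[v1 v13 v12] [w1 w13 w12]; split=> /=.
  + exact: geMl.
  + rewrite (_ : v.2 * w.2 - _ = w.2 * (v.2 - v.1.1) + v.1.1 * (w.2 - w.1.1)).
      by apply: geD; apply: geMl.
    by ring.
  + pose r := (v.2 - v.1.1) / pi ^+ b; pose s := (w.2 - w.1.1) / pi ^+ b.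
    (* The defect of the product is expressed by the defects of the two factors and the single new
       term [c (c - pi^b) r s]. *)
    rewrite (_ : _ - _ = c * (c - pi ^+ b) * (r * s)
      + w.1.2 * (v.1.2 - v.1.1 - c * r)
      + (v.1.1 + c * r) * (w.1.2 - w.1.1 - c * s)); last first.
      by rewrite /r /s; field.
    have r0 : ge 0 r by apply: ge_divX.
    have s0 : ge 0 s by apply: ge_divX.
    apply: geD; first apply: geD.
    * by apply: geMr => //; apply: geMl.
    * exact: geMl.
    * by apply: geMl => //; apply: geD => //; apply: geMl.
- rewrite -OabcE => k ok; apply: OZ => //; exact: Oabc_one.
- by rewrite -OabcE; eexists; reflexivity.
- by rewrite -OabcE; apply: cofinite_spans; apply: Oabc_cofinite.
Qed.

(** Inclusion is tested on generators: [(0,pi^a,0)] yields [a' <= a], while [(0,c,pi^b)] yields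
    [b' <= b] and the congruence, scaled by [pi^(b-b')]. *)
Lemma Oabc_subset a b c a' b' c' :
  O_ a b c `<=` O_ a' b' c' <-> [/\ (a' <= a)%N, (b' <= b)%N &
    ge (a'%:Z - (b%:Z - b'%:Z)) (c' - pi ^ (- (b%:Z - b'%:Z)) * c)].
Proof.
have E (n : nat) : pi ^+ n != 0 by rewrite expf_neq0 // pi_neq0.
have P : (b' <= b)%N -> ge (a'%:Z - (b%:Z - b'%:Z)) (c' - pi ^ (- (b%:Z - b'%:Z)) * c)
    <-> ge a' (c - c' * (pi ^+ b / pi ^+ b')).
  move=> bb; rewrite subzn // -exprnN.
  have -> : pi ^+ b / pi ^+ b' = pi ^+ (b - b') by rewrite expfB_cond ?(negPf pi_neq0) .
  rewrite -ge_piX_mul mulrBr mulrA mulfV // mul1r.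
  by split=> /geN; rewrite opprB [c' * _]mulrC.
split=> [sub|[aa bb /(P bb) cc]].
  have gen : forall g : V, g \in ([:: (1, 1, 1); (0, pi ^+ a, 0); (0, c, pi ^+ b)] : seq V)
      -> in_abc a' b' c' g.
    move=> g gin; rewrite -OabcE; apply: sub.
    by rewrite -[g]scale1r; apply: sums_act => //; apply: ge1.
  have [|_ _] := gen (0, pi ^+ a, 0); first by rewrite !inE eqxx orbT.
  rewrite /= !subr0 mul0r mulr0 subr0 => /ge_Xnat aa.
  have [|_] := gen (0, c, pi ^+ b); first by rewrite !inE eqxx !orbT.
  by rewrite /= !subr0 => /ge_Xnat bb cc; split=> //; apply/P.
rewrite [X in _ `<=` X]OabcE.
apply: sub_sums (in_abc_omodule _ _ _) _ => x /=.
rewrite !inE => /or3P[] /eqP->; split=> /=.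
- exact: ge1.
- by rewrite subrr; apply: ge0.
- by rewrite !subrr mul0r mulr0 subr0; apply: ge0.
- exact: ge0.
- by rewrite subrr; apply: ge0.
- by rewrite !subr0 mul0r mulr0 subr0; apply/ge_Xnat.
- exact: ge0.
- by rewrite subr0; apply/ge_Xnat.
- by rewrite !subr0.
Qed.

(** * Lattices containing (1,1,1), and orders *)

Lemma ord_nat x : ge 0 x -> x != 0 -> exists n : nat, ord x = n%:Z%:E.
Proof.
move=> x0 xn0; have [[xe]|[_ [n xn]]] := ordP x; first by rewrite xe eqxx in xn0.
by move: x0; rewrite /ge xn lee_fin; case: n xn => // n xn _; exists n.
Qed.

Lemma ge_div n x y : ord x = n%:E -> ge n y -> ge 0 (y / x).
Proof. by move=> /geV xn yn; rewrite -(subrr n); apply: geM. Qed.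

Lemma omoduleB M v w : omodule ord M -> M v -> M w -> M (v - w).
Proof.
move=> [_ MD MZ] Mv Mw; apply: MD => //; rewrite -scaleN1r; apply: MZ => //.
exact/geN/ge1.
Qed.

(** Stated for modules rather than orders, because the length computation applies it to every member
    of a chain. *)
Lemma omodule_Oabc M : omodule ord M -> M 1 -> M `<=` max_order ord -> cofinite M ->
  exists (a b : nat) (c : F), oF c /\ M = O_ a b c.
Proof.
move=> Mo M1 Mmax [N MN]; have [M0 MD MZ] := Mo.
have E n : pi ^ n != 0 by rewrite expfz_neq0 // pi_neq0.
have XE (n : nat) : pi ^+ n != 0 by apply: (E n).
have red v : M v -> M (v - v.1.1 *: 1).
  by move=> Mv; apply: omoduleB => //; apply: MZ => //; case/max_orderP: (Mmax _ Mv).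
have [b [v Mv vb] bmin] : exists2 b : nat,
    exists2 v, M v & ord (v.2 - v.1.1) = b%:Z%:E &
    forall m : nat, (exists2 v, M v & ord (v.2 - v.1.1) = m%:Z%:E) -> (b <= m)%N.
  apply: ex_min_nat; exists N, (pi ^+ N *: ((0, 0, 1) : V)).
    by apply: MN; apply: max_e3.
  by rewrite /= /GRing.scale /= mulr0 mulr1 subr0 ordX.
have [a [w [Mw w1 w2] wa] amin] : exists2 a : nat,
    exists2 w, [/\ M w, w.1.1 = 0 & w.2 = 0] & ord w.1.2 = a%:Z%:E &
    forall m : nat, (exists2 w, [/\ M w, w.1.1 = 0 & w.2 = 0] &
      ord w.1.2 = m%:Z%:E) -> (a <= m)%N.
  apply: ex_min_nat; exists N, (pi ^+ N *: ((0, 1, 0) : V)).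
    split; rewrite /= /GRing.scale /= ?mulr0 //.
    by apply: MN; apply: max_e2.
  by rewrite /= /GRing.scale /= mulr1 ordX.
pose d := v.2 - v.1.1; have d0 : d != 0 := ord_neq0 vb.
(* Since [d] has valuation [b], the factor [pi^b / d] is a unit; it makes the last entry exactly
   [pi^b]. *)
pose q : V := (pi ^+ b / d) *: (v - v.1.1 *: 1).
have Mq : M q by apply: MZ (red _ Mv); apply: ge_div vb _; apply: geX.
have q1 : q.1.1 = 0 by rewrite /q /= /GRing.scale /= mulr1 subrr mulr0.
have q3 : q.2 = pi ^+ b by rewrite /q /= /GRing.scale /= mulr1 divfK.
clearbody q.
have Mp : M (0, pi ^+ a, 0).
  have -> : (0, pi ^+ a, 0) = (pi ^+ a / w.1.2) *: w.
    apply: cubic_ext; rewrite !cubicE ?w1 ?w2 ?mulr0 //= divfK //.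
    exact: ord_neq0 wa.
  by apply: MZ Mw; apply: ge_div wa _; apply: geX.
have qE : q = (0, q.1.2, pi ^+ b) by apply: cubic_ext.
exists a, b, q.1.2; split; first by case/max_orderP: (Mmax _ Mq).
rewrite eqEsubset; split=> [x Mx|]; last first.
  apply: sub_sums => // x; rewrite /= !inE => /or3P[] /eqP-> //.
  by rewrite -qE.
have /max_orderP[x1 x2 x3] := Mmax _ Mx.
have bx : ge b (x.2 - x.1.1).
  have [->|nz] := eqVneq (x.2 - x.1.1) 0; first exact: ge0.
  have [n xn] := ord_nat (geB x3 x1) nz.
  by rewrite /ge xn lee_fin lez_nat; apply: bmin; exists x.
rewrite OabcE; split=> //.
(* Subtracting multiples of [1] and [q] kills the outer entries of [x], so the minimality of [a]
   applies to what remains. *)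
pose y := x - x.1.1 *: 1 - ((x.2 - x.1.1) / pi ^+ b) *: q.
have My : M y by apply: omoduleB (red _ Mx) _ => //; apply: MZ => //; apply: ge_divX.
have y1 : y.1.1 = 0 by rewrite /y /= /GRing.scale /= q1 mulr1 subrr mulr0 subrr.
have y3 : y.2 = 0.
  by rewrite /y /= /GRing.scale /= q3 mulr1 divfK // subrr.
have y2 : y.1.2 = x.1.2 - x.1.1 - q.1.2 * ((x.2 - x.1.1) / pi ^+ b).
  by rewrite /y /= /GRing.scale /=; ring.
rewrite -y2; have /max_orderP[_ y20 _] := Mmax _ My.
have [->|nz] := eqVneq y.1.2 0; first exact: ge0.
have [n yn] := ord_nat y20 nz.
by rewrite /ge yn lee_fin lez_nat; apply: amin; exists y.
Qed.

Definition bounded M :=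
  exists n : nat, forall v, M v -> max_order ord (pi ^+ n *: v).

Lemma max_omodule : omodule ord (max_order ord).
Proof.
split=> [|v w|k v ok].
- by apply/max_orderP; split; apply: ge0.
- by move=> /max_orderP[? ? ?] /max_orderP[? ? ?]; apply/max_orderP; split; apply: geD.
- by move=> /max_orderP[? ? ?]; apply/max_orderP; split; apply: geMl.
Qed.

Lemma maxM v w : max_order ord v -> max_order ord w -> max_order ord (v * w).
Proof.
by move=> /max_orderP[? ? ?] /max_orderP[? ? ?]; apply/max_orderP; split; apply: geMl.
Qed.

Lemma max_scaleX v (m n : nat) : (m <= n)%N ->
  max_order ord (pi ^+ m *: v) -> max_order ord (pi ^+ n *: v).
Proof.
have [_ _ mZ] := max_omodule.
move=> mn vm; rewrite -(subnK mn) exprD -scalerA; apply: mZ => //.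
by apply: ge_trans (geX _).
Qed.

Lemma clear_denominator x : exists n : nat, ge 0 (pi ^+ n * x).
Proof.
have [[-> _]|[_ [m xm]]] := ordP x; first by exists 0%N; rewrite mulr0; apply: ge0.
by exists `|m|%N; apply/ge_piX_mul; rewrite /ge xm lee_fin; lia.
Qed.

Lemma max_clear v : exists n : nat, max_order ord (pi ^+ n *: v).
Proof.
have [[n1 v1] [n2 v2] [n3 v3]] :
  [/\ exists n : nat, ge 0 (pi ^+ n * v.1.1), exists n : nat, ge 0 (pi ^+ n * v.1.2)
    & exists n : nat, ge 0 (pi ^+ n * v.2)] by split; apply: clear_denominator.
exists (n1 + n2 + n3)%N; apply/max_orderP; rewrite !cubicE.
split; apply/ge_piX_mul; [move/ge_piX_mul: v1|move/ge_piX_mul: v2|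
  move/ge_piX_mul: v3]; apply: ge_trans; lia.
Qed.

Lemma max_clear_seq (s : seq V) :
  exists n : nat, forall v, v \in s -> max_order ord (pi ^+ n *: v).
Proof.
elim: s => [|v s [n sn]]; first by exists 0%N.
have [m vm] := max_clear v; exists (m + n)%N => w.
rewrite inE => /orP[/eqP ->|/sn wn]; [apply: max_scaleX vm|apply: max_scaleX wn]; lia.
Qed.

(** Every vector is an [F]-combination of elements of [M], so a power of [pi] moves it into [M];
    three unit vectors need one common power. *)
Lemma spans_cofinite M : omodule ord M -> spans_F M -> cofinite M.
Proof.
move=> [M0 MD MZ] sM.
have clear v : exists n : nat, M (pi ^+ n *: v).
  have : sums *:%R setT M v by rewrite sM.
  move: v; apply: sums_ind => [|v w [m Mv] [n Mw]|k v _ Mv].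
  - by exists 0%N; rewrite scaler0.
  - exists (m + n)%N; rewrite scalerDr [in X in M (X + _)]addnC !exprD -!scalerA.
    by apply: (MD); apply: (MZ) => //; apply: ge_trans (geX _).
  - have [n kn] := clear_denominator k; exists n.
    by rewrite scalerA; apply: MZ.
have [[n1 M1] [n2 M2] [n3 M3]] :
  [/\ exists n : nat, M (pi ^+ n *: ((1, 0, 0) : V)),
      exists n : nat, M (pi ^+ n *: ((0, 1, 0) : V))
    & exists n : nat, M (pi ^+ n *: ((0, 0, 1) : V))] by split; apply: clear.
exists (n1 + n2 + n3)%N => v /max_orderP[v1 v2 v3].
have -> : pi ^+ (n1 + n2 + n3) *: v =
  (pi ^+ (n2 + n3) * v.1.1) *: (pi ^+ n1 *: ((1, 0, 0) : V)) +
  (pi ^+ (n1 + n3) * v.1.2) *: (pi ^+ n2 *: ((0, 1, 0) : V)) +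
  (pi ^+ (n1 + n2) * v.2) *: (pi ^+ n3 *: ((0, 0, 1) : V)).
  by apply: cubic_ext => /=; rewrite /GRing.scale /= !exprD; ring.
by apply: (MD); first apply: (MD); apply: (MZ) => //; apply: geMl => //;
  apply: ge_trans (geX _).
Qed.

(** If [ord x] were negative, [x^(n+1)] would have valuation at most [-(n+1)]. *)
Lemma ge_scaled_bounded x (n : nat) :
  (forall k : nat, ge (- n%:Z) (x ^+ k)) -> ge 0 x.
Proof.
move=> h; have [[-> _]|[_ [m xm]]] := ordP x; first exact: ge0.
have ordXk k : ord (x ^+ k) = (m * k%:Z)%:E.
  elim: k => [|k IH]; first by rewrite expr0 ord1 mulr0.
  by rewrite exprS (ord_mul ord_val) xm IH -EFinD; congr (_%:E); lia.
have := h n.+1; rewrite /ge xm ordXk !lee_fin; nia.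
Qed.

Lemma is_order_omodule O : is_order ord O -> omodule ord O.
Proof.
move=> [O1 OB OM Oi _ _]; have O0 : O 0 by rewrite -(subrr 1); apply: OB.
split=> // [v w Ov Ow|k v ok Ov].
  by rewrite -[w]opprK; apply: (OB) => //; rewrite -(sub0r w); apply: OB.
by rewrite -mulr_algl; apply: OM => //; apply: Oi.
Qed.

(** Finite generation bounds all denominators in [O] by one power of [pi]. Powers of an element stay
    in [O], so [ge_scaled_bounded] applies to each entry. *)
Lemma is_order_max O : is_order ord O -> O `<=` max_order ord.
Proof.
move=> Oo; have [O1 OB OM Oi [s Os] _] := Oo.
have [n sn] := max_clear_seq s.
have On : forall w, O w -> max_order ord (pi ^+ n *: w).
  have [m0 mD mZ] := max_omodule.
  rewrite Os; apply: sums_ind => [|u u' ? ?|k u ok us]; first by rewrite scaler0.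
    by rewrite scalerDr; apply: mD.
  by rewrite scalerA mulrC -scalerA; apply: (mZ) => //; apply: sn.
move=> v Ov; have Ovk k : O (v ^+ k).
  by elim: k => [|k IH]; rewrite ?expr0 // exprS; apply: OM.
have pw k : [/\ (v ^+ k).1.1 = v.1.1 ^+ k, (v ^+ k).1.2 = v.1.2 ^+ k
    & (v ^+ k).2 = v.2 ^+ k].
  elim: k => [|k [e1 e2 e3]]; first by rewrite !expr0.
  by rewrite exprS /= e1 e2 e3 !exprS.
by apply/max_orderP; split; apply: (@ge_scaled_bounded _ n) => k;
  have [e1 e2 e3] := pw k; have /max_orderP[] := On _ (Ovk k);
  rewrite !cubicE ?e1 ?e2 ?e3 => /ge_piX_mul h1 /ge_piX_mul h2 /ge_piX_mul h3;
  rewrite -(sub0r n%:Z).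
Qed.

Lemma order_Oabc O : is_order ord O ->
  exists (a b : nat) (c : F), oF c /\ O = O_ a b c.
Proof.
move=> Oo; apply: omodule_Oabc; [exact: is_order_omodule|by case: Oo|
  exact: is_order_max|].
by apply: spans_cofinite; [apply: is_order_omodule|case: Oo].
Qed.

(** * Inclusions and length *)

(** The comparison of [ord c] with [b] determines [ord (c - pi^b)] unless they are equal. The later
    case analyses thereby become integer arithmetic. *)
Lemma ord_cases (b : nat) c :
  [\/ (ord c < b%:Z%:E)%E /\ ord (c - pi ^+ b) = ord c,
      (b%:Z%:E < ord c)%E /\ ord (c - pi ^+ b) = b%:Z%:E |
      ord c = b%:Z%:E /\ (b%:Z%:E <= ord (c - pi ^+ b))%E].
Proof.
have [cb|cb|cb] := ltgtP (ord c) b%:Z%:E.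
- by constructor 1; split=> //; apply: ord_addr_lt; rewrite ordN ordX.
- by constructor 2; split=> //; rewrite addrC ord_addr_lt ordN ordX.
- by constructor 3; split=> //; apply: geB (geX b); rewrite /ge cb.
Qed.

(** In the three cases of [ord_cases] the product has valuation [2 ord c], [ord c + b] or
    [b + ord (c - pi^b)], to be compared with [a]. *)
Lemma order_conditionP a b c : oF c ->
  order_condition ord pi a b c <-> ge a (c * (c - pi ^+ b)).
Proof.
move=> oc.
have shift j : [set pi ^+ b + y | y in pi_ideal ord pi j] c <-> ge j (c - pi ^+ b).
  split=> [[y /pi_idealP yj <-]|/pi_idealP cj]; first by rewrite addrC addKr.
  by exists (c - pi ^+ b) => //; rewrite addrC subrK.
rewrite /order_condition.
have -> : (if (a <= 2 * b)%N then pi_ideal ord pi (uphalf a) c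
  else pi_ideal ord pi (a%:Z - b%:Z) c \/
       [set pi ^+ b + y | y in pi_ideal ord pi (a%:Z - b%:Z)] c) <->
  if (a <= 2 * b)%N then ge (uphalf a) c
  else ge (a%:Z - b%:Z) c \/ ge (a%:Z - b%:Z) (c - pi ^+ b).
  by case: ifP => _; rewrite ?shift !pi_idealP.
rewrite /ge (ord_mul ord_val); have := oc; rewrite /integers /=.
have := uphalf_half a; have := odd_double_half a.
case: (ord_cases b c) => -[].
- move=> + ->; case: (ord c) => // m; rewrite -EFinD !lee_fin lte_fin.
  by case: ifP => h; lia.
- move=> + ->; case: (ord c) => [m| |] //=; last first.
    by rewrite !leey; case: ifP => // _; tauto.
  by rewrite -EFinD !lee_fin lte_fin; case: ifP => h; lia.
- move=> ->; case: (ord (c - pi ^+ b)) => [m| |] //=; last first.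
    rewrite !leey !lee_fin; case: ifP => h; last by tauto.
    by split=> // _; lia.
  by rewrite -EFinD !lee_fin; case: ifP => h; lia.
Qed.

(** If [ord c >= a'], then [pi^(-k) c] already lies in the ideal, so both cases state the same
    congruence. *)
Lemma ge_subset_cond a' (k : int) c c' :
  (if (a'%:Z%:E <= ord c)%E then pi_ideal ord pi (a'%:Z - k) c'
   else pi_ideal ord pi (a'%:Z - k) (c' - pi ^ (- k) * c)) <->
  ge (a'%:Z - k) (c' - pi ^ (- k) * c).
Proof.
case: ifP => [ac|_]; rewrite pi_idealP //.
have h : ge (a'%:Z - k) (pi ^ (- k) * c) by apply/ge_piz_mul; rewrite opprK subrK.
split=> [?|h2]; first exact: geB.
by rewrite -[c'](subrK (pi ^ (- k) * c)); apply: geD.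
Qed.

(** With [k = b - b'], the difference [c' - pi^(-k) c] has valuation at least [a' - k], more than
    that of [pi^(-k) c], which [c'] therefore shares. *)
Lemma Oabc_subset_ord a b c a' b' c' : O_ a b c `<=` O_ a' b' c' ->
  (ord c < a'%:Z%:E)%E -> ord c' = (ord c - (b%:Z - b'%:Z)%:E)%E.
Proof.
move=> /Oabc_subset[_ _]; set k := _ - b'%:Z => h ca.
have kc : ord (pi ^ (- k) * c) = (ord c - k%:E)%E.
  by rewrite (ord_mul ord_val) ord_piz addeC.
rewrite -[c'](subrK (pi ^ (- k) * c)) addrC ord_addr_lt // kc.
apply: lt_le_trans h; move: ca; case: (ord c) => [m| |] //=.
  by rewrite -EFinB !lte_fin; lia.
by move=> _; apply: ltNyr.
Qed.

Lemma Oabc_eq a b c a' b' c' : O_ a' b' c' = O_ a b c <->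
  [/\ a = a', b = b' & pi_ideal ord pi a (c - c')].
Proof.
split=> [E|[<- <- /pi_idealP cc]].
  have /Oabc_subset[aa bb _] : O_ a b c `<=` O_ a' b' c' by rewrite E.
  have /Oabc_subset[aa' bb'] : O_ a' b' c' `<=` O_ a b c by rewrite E.
  have -> : b = b' by lia.
  have -> : a = a' by lia.
  rewrite subrr oppr0 expr0z mul1r subr0 => h.
  by split=> //; apply/pi_idealP.
by rewrite eqEsubset; split; apply/Oabc_subset; split=> //;
  rewrite subrr oppr0 expr0z mul1r subr0 // -opprB; apply: geN.
Qed.

(** The chain lowers [a] to [0] and then [b]; truncated subtraction keeps [i - a] at [0] during the
    first phase. Once [a] is [0], the congruence on [c] follows from integrality. *)
Lemma Oabc_chain a b c : oF c -> quotient_chain ord (max_order ord) (O_ a b c)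
  (a + b)%N (fun i : nat => O_ (a - i)%N (b - (i - a))%N c).
Proof.
move=> oc.
have sub (a1 b1 a2 b2 : nat) : (a1 <= a2)%N -> (b1 <= b2)%N ->
    (b1 = b2 \/ a1 = 0%N) -> O_ a2 b2 c `<=` O_ a1 b1 c.
  move=> aa bb ab; apply/Oabc_subset; split=> //; case: ab => [->|->].
    by rewrite subrr oppr0 expr0z mul1r subrr; apply: ge0.
  apply: geB; last by apply/ge_piz_mul; rewrite sub0r subrr.
  by apply: ge_trans oc; lia.
split=> i ia.
  split; [exact: Oabc_omodule| |exact: Oabc_max].
  by apply: sub; lia.
split; first by (apply: sub; lia).
by move=> /Oabc_subset[]; lia.
Qed.

(** Inclusion gives [a' <= a] and [b' <= b]. If the sum did not drop, both would be equalities and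
    the congruence would make the modules equal. *)
Lemma Oabc_proper a b c a' b' c' :
  O_ a b c `<` O_ a' b' c' -> (a' + b' < a + b)%N.
Proof.
move=> [sub nsub]; have /Oabc_subset[aa bb cc] := sub.
rewrite ltnNge; apply/negP => le; apply: nsub.
have ea : a' = a by lia.
have eb : b' = b by lia.
subst a' b'; suff -> : O_ a b c' = O_ a b c by [].
by apply/Oabc_eq; split=> //; apply/pi_idealP; move: cc;
  rewrite subrr oppr0 expr0z mul1r subr0 -opprB => /geN; rewrite opprK.
Qed.

Lemma Oabc_length a b c : oF c ->
  quotient_length ord (max_order ord) (O_ a b c) (a + b)%N.
Proof.
move=> oc; split; first by eexists; apply: Oabc_chain.
move=> m W [Wm Wlt].
have WE (i : nat) : (i <= m)%N -> exists (a' b' : nat) (c' : F), W i = O_ a' b' c'.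
  move=> /Wm[Wo sub Wmax].
  have [||a' [b' [c' [_ ->]]]] := omodule_Oabc Wo _ Wmax.
  - exact/sub/Oabc_one.
  - by have [N ON] := Oabc_cofinite a b oc; exists N => v /ON /sub.
  - by exists a', b', c'.
(* Each of the first [i] strict inclusions costs at least one unit of [a + b]; taking [i = m] bounds
   the length. *)
suff h (i : nat) : (i <= m)%N ->
    forall a' b' c', W i = O_ a' b' c' -> (a' + b' + i <= a + b)%N.
  have [a' [b' [c' We]]] := WE m (leqnn m).
  by have := h m (leqnn m) _ _ _ We; lia.
elim: i => [_|i IH im] a' b' c' We.
  have [_ + _] := Wm 0%N (leq0n m); rewrite We => /Oabc_subset[]; lia.
have [a1 [b1 [c1 We1]]] := WE i (ltnW im).
have := Wlt i im; rewrite We We1 => /Oabc_proper.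
by have := IH (ltnW im) _ _ _ We1; lia.
Qed.

(** * The conductor *)

(** Two bounds on [x] merge into one exponent. For [d = 0] the second bound is vacuous, matching
    [ord d = +oo], and the maximum is [b]. *)
Lemma conductor_exponent (a b : nat) d : ge 0 d -> exists f : int,
  f%:E = Order.max b%:Z%:E ((a%:Z + b%:Z)%:E - ord d)%E /\
  forall x, ge f x <-> ge b x /\ ge (a%:Z + b%:Z) (x * d).
Proof.
move=> d0; have [[-> d1]|[_ [m dm]]] := ordP d.
  exists b; rewrite (ord_zero ord_val); split; first by rewrite max_l.
  by move=> x; rewrite mulr0; split=> [?|[]//]; split=> //; apply: ge0.
exists (Num.max b%:Z (a%:Z + b%:Z - m)); split.
  by rewrite dm -EFinB EFin_max.
move=> x; rewrite /ge (ord_mul ord_val) dm.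
have [[_ ->]|[_ [k ->]]] := ordP x; first by rewrite !leey.
by rewrite -EFinD !lee_fin; lia.
Qed.

(** The maximal order is spanned by its three idempotents, so [v] is in the conductor when each
    entry, placed alone on its axis, lies in the module. *)
Lemma conductorP a b c v : oF c -> conductor ord (O_ a b c) v <->
  [/\ ge b v.1.1 /\ ge (a%:Z + b%:Z) (v.1.1 * (c - pi ^+ b)), ge a v.1.2 &
      ge b v.2 /\ ge (a%:Z + b%:Z) (v.2 * c)].
Proof.
move=> oc; have E : pi ^+ b != 0 by rewrite expf_neq0 // pi_neq0.
have [_ OD _] := Oabc_omodule a b c.
have O1 y : O_ a b c (y, 0, 0) <->
    [/\ ge 0 y, ge b y & ge (a%:Z + b%:Z) (y * (c - pi ^+ b))].
  rewrite OabcE /in_abc /= !sub0r.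
  rewrite (_ : - y - _ = y * (c - pi ^+ b) / pi ^+ b); last by field.
  split=> -[h1 h2 /ge_divXE h3]; split=> //; last exact: geN.
  by rewrite -[y]opprK; apply: geN.
have O2 y : O_ a b c (0, y, 0) <-> ge a y.
  rewrite OabcE /in_abc /= !subr0 mul0r mulr0 subr0.
  by split=> [[]|h] //; split=> //; apply: ge0.
have O3 y : O_ a b c (0, 0, y) <-> ge b y /\ ge (a%:Z + b%:Z) (y * c).
  rewrite OabcE /in_abc /= !subr0 sub0r mulrCA mulrA mulrC.
  split=> [[_ h1 /geN]|[h1 /ge_divXE h2]].
    by rewrite opprK mulrC => /ge_divXE; rewrite mulrC.
  by split=> //; [exact: ge0|apply: geN; rewrite mulrC].
split=> [[_ vO]|[[h1 h2] h3 [h4 h5]]].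
  have e1 : O_ a b c (v.1.1, 0, 0).
    have := vO (1, 0, 0); rewrite [v * _](_ : _ = (v.1.1, 0, 0)).
      by apply; apply: max_e1.
    by apply: cubic_ext; rewrite /= ?mulr0 ?mulr1.
  have e2 : O_ a b c (0, v.1.2, 0).
    have := vO (0, 1, 0); rewrite [v * _](_ : _ = (0, v.1.2, 0)).
      by apply; apply: max_e2.
    by apply: cubic_ext; rewrite /= ?mulr0 ?mulr1.
  have e3 : O_ a b c (0, 0, v.2).
    have := vO (0, 0, 1); rewrite [v * _](_ : _ = (0, 0, v.2)).
      by apply; apply: max_e3.
    by apply: cubic_ext; rewrite /= ?mulr0 ?mulr1.
  by move: e1 e2 e3 => /O1[_ ? ?] /O2 ? /O3 ?.
have nn (n : nat) x : ge n x -> ge 0 x by apply: ge_trans.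
split; first by apply/max_orderP; split; [exact: nn h1|exact: nn h3|exact: nn h4].
move=> w /max_orderP[w1 w2 w3].
have -> : v * w = ((v.1.1 * w.1.1, 0, 0) : V) + ((0, v.1.2 * w.1.2, 0) : V)
   + ((0, 0, v.2 * w.2) : V).
  by apply: cubic_ext; rewrite /= ?(addr0, add0r).
apply: (OD); first apply: (OD).
- apply/O1; split; [|exact: geMr|by rewrite mulrAC; apply: geMr].
  by apply: nn; apply: geMr h1 w1.
- by apply/O2; apply: geMr.
- by apply/O3; split; [exact: geMr|rewrite mulrAC; apply: geMr].
Qed.

Lemma Oabc_conductor a b c : oF c -> exists f1 f2 f3 : int,
  [/\ conductor ord (O_ a b c) =
        pi_ideal ord pi f1 `*` pi_ideal ord pi f2 `*` pi_ideal ord pi f3,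
      [/\ f1%:E = Order.max b%:Z%:E
                    ((a%:Z + b%:Z)%:E - ord (c - pi ^+ b)%R)%E,
          f2 = a%:Z &
          f3%:E = Order.max b%:Z%:E ((a%:Z + b%:Z)%:E - ord c)%E],
      (a%:Z%:E <= ord c)%E -> f1 = (maxn a b)%:Z /\ f3 = b%:Z &
      (ord c < a%:Z%:E)%E ->
        f1%:E = Order.max b%:Z%:E
                  ((a%:Z + b%:Z)%:E - ord (c - pi ^+ b)%R)%E /\
        f3%:E = ((a%:Z + b%:Z)%:E - ord c)%E].
Proof.
move=> oc.
have od : ge 0 (c - pi ^+ b) by apply: geB oc _; apply: ge_trans (geX b).
have [f1 [f1E f1P]] := conductor_exponent a b od.
have [f3 [f3E f3P]] := conductor_exponent a b oc.
exists f1, a, f3; split=> //.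
- rewrite eqEsubset; split=> v.
    move=> /(conductorP _ _ _ oc)[/f1P h1 h2 /f3P h3].
    by split; first split; apply/pi_idealP.
  by move=> [[/pi_idealP/f1P ? /pi_idealP ?] /pi_idealP/f3P ?]; apply/conductorP.
(* When [a <= ord c], the value [a + b - ord (c - pi^b)] can exceed [b] only if [b < ord c], and
   then it equals [a]. *)
- move: f1E f3E oc; rewrite /integers /=; case: (ord_cases b c) => -[].
  + move=> + ->; case: (ord c) => // m; rewrite lte_fin -EFinB -EFin_max.
    by rewrite !lee_fin => mb [->] [->]; lia.
  + move=> + ->; case: (ord c) => // [m|].
      rewrite lte_fin -!EFinB -!EFin_max.
      by rewrite !lee_fin => mb [->] [->]; lia.
    rewrite -EFinB -EFin_max => _ [->].
    by rewrite max_l // => -[->] _ _; lia.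
  + move=> ->; rewrite lee_fin -EFinB -EFin_max; case: (ord (c - pi ^+ b)) => // [m|].
      by rewrite -EFinB -EFin_max !lee_fin => mb [->] [->]; lia.
    by rewrite max_l // !lee_fin => _ [->] [->]; lia.
- move: f3E oc; rewrite /integers /=; case: (ord c) => [m| |] //.
  rewrite lee_fin -EFinB -EFin_max lte_fin => -[->] m0 ma; split=> //.
  by congr (_%:E); lia.
Qed.

Implicit Types (v w u : V).

(** * Trace duality of lattices *)

Lemma trD v w : tr (v + w) = tr v + tr w.
Proof. by rewrite /tr /=; ring. Qed.

Lemma trZ k v : tr (k *: v) = k * tr v.
Proof. by rewrite /tr !cubicE; ring. Qed.

Lemma tr_max v : max_order ord v -> ge 0 (tr v).
Proof. by move=> /max_orderP[? ? ?]; apply: geD => //; apply: geD. Qed.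

(** Being squeezed between two multiples of the maximal order replaces finite generation: it passes
    directly to duals and products, and [lattice_basis] recovers generators. *)
Definition lattice M := [/\ omodule ord M, bounded M & cofinite M].

Definition dual M : set V := [set w | forall v, M v -> ge 0 (tr (v * w))].

Lemma dual_omodule M : omodule ord (dual M).
Proof.
split=> [v _|v w dv dw u Mu|k v ok dv u Mu].
- by rewrite mulr0 /tr /= !addr0; apply: ge0.
- by rewrite mulrDr trD; apply: geD; [apply: dv|apply: dw].
- by rewrite -scalerAr trZ; apply: geMl => //; apply: dv.
Qed.

(** Duality exchanges the two bounds: pairing with [pi^n] times the unit vectors bounds the dual,
    and boundedness of [M] makes the dual cofinite. *)
Lemma dual_lattice M : lattice M -> lattice (dual M).
Proof.
move=> [Mo [m Mm] [n nM]]; split; first exact: dual_omodule.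
  exists n => v dv; apply/max_orderP; rewrite !cubicE; split.
  - have /dv := nM _ max_e1.
    by rewrite /tr /= /GRing.scale /= mulr1 !mulr0 !mul0r !addr0.
  - have /dv := nM _ max_e2.
    by rewrite /tr /= /GRing.scale /= mulr1 !mulr0 !mul0r add0r !addr0.
  - have /dv := nM _ max_e3.
    by rewrite /tr /= /GRing.scale /= mulr1 !mulr0 !mul0r !add0r.
exists m => w wmax v Mv; rewrite -scalerAr scalerAl.
by apply: tr_max; apply: maxM => //; apply: Mm.
Qed.

Lemma tr_cross v w u k : tr (v * (k *: cross w u)) = det v w u * k.
Proof. by rewrite /tr /det /= /GRing.scale /=; ring. Qed.

(* A triple of lattice vectors with determinant of least valuation is a basis,
   by Cramer's rule. *)
Lemma lattice_basis M : lattice M -> exists e1 e2 e3 : V,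
  [/\ [/\ M e1, M e2 & M e3], det e1 e2 e3 != 0 & forall v, M v ->
    [/\ ge 0 (det v e2 e3 / det e1 e2 e3), ge 0 (det v e3 e1 / det e1 e2 e3)
      & ge 0 (det v e1 e2 / det e1 e2 e3)]].
Proof.
move=> [[M0 MD MZ] [n Mn] [N NM]].
have E (m : nat) : pi ^+ m != 0 by rewrite expf_neq0 // pi_neq0.
(* The factor [pi^(3n)] makes determinants of lattice vectors integral, so their valuations are
   natural numbers and have a minimum. *)
have detM v w u : M v -> M w -> M u -> ge 0 (pi ^+ (n + n + n) * det v w u).
  move=> /Mn/max_orderP[v1 v2 v3] /Mn/max_orderP[w1 w2 w3] /Mn/max_orderP[u1 u2 u3].
  have -> : pi ^+ (n + n + n) * det v w u = det (pi ^+ n *: v) (pi ^+ n *: w) (pi ^+ n *: u).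
    by rewrite /det !cubicE !exprD; ring.
  by apply: geD; first apply: geB; apply: geMl => //; apply: geB; apply: geMl.
have nat_det v w u : M v -> M w -> M u -> det v w u != 0 ->
    exists m : nat, ord (pi ^+ (n + n + n) * det v w u) = m%:Z%:E.
  by move=> *; apply: ord_nat; [apply: detM|rewrite mulf_neq0].
have [m [e1 [e2 [e3 [M1 M2 M3 em]]]] mmin] : exists2 m : nat,
    exists e1 e2 e3, [/\ M e1, M e2, M e3 &
      ord (pi ^+ (n + n + n) * det e1 e2 e3) = m%:Z%:E] &
    forall k : nat, (exists e1 e2 e3, [/\ M e1, M e2, M e3 &
      ord (pi ^+ (n + n + n) * det e1 e2 e3) = k%:Z%:E]) -> (m <= k)%N.
  apply: ex_min_nat.
  have M1 : M (pi ^+ N *: ((1, 0, 0) : V)).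
    by apply: NM; apply: max_e1.
  have M2 : M (pi ^+ N *: ((0, 1, 0) : V)).
    by apply: NM; apply: max_e2.
  have M3 : M (pi ^+ N *: ((0, 0, 1) : V)).
    by apply: NM; apply: max_e3.
  have [|m mE] := nat_det _ _ _ M1 M2 M3; last first.
    by exists m; do 3!eexists; split; [exact: M1|exact: M2|exact: M3|exact: mE].
  rewrite (_ : det _ _ _ = pi ^+ N * (pi ^+ N * pi ^+ N)); first by rewrite !mulf_neq0.
  by rewrite /det /= /GRing.scale /=; ring.
exists e1, e2, e3; split=> //.
  by have := ord_neq0 em; rewrite mulf_eq0 negb_or => /andP[].
have minor v w u : M v -> M w -> M u -> ge 0 (det v w u / det e1 e2 e3).
  move=> Mv Mw Mu; have [->|nz] := eqVneq (det v w u) 0; first by rewrite mul0r; apply: ge0.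
  have [k kE] := nat_det _ _ _ Mv Mw Mu nz.
  rewrite -[_ / _]mul1r -(divff (E (n + n + n)%N)) mulf_div.
  apply: ge_div em _; rewrite /ge kE lee_fin lez_nat; apply: mmin.
  by exists v, w, u.
by move=> v Mv; split; apply: minor.
Qed.

Lemma cramer (e1 e2 e3 v : V) : det e1 e2 e3 != 0 ->
  v = (det v e2 e3 / det e1 e2 e3) *: e1 + (det v e3 e1 / det e1 e2 e3) *: e2
    + (det v e1 e2 / det e1 e2 e3) *: e3.
Proof.
move=> d0.
have divE (x a b c p q r d : F) : d != 0 -> x * d = a * p + b * q + c * r ->
    x = a / d * p + b / d * q + c / d * r.
  by move=> dn0 e; rewrite -[LHS](mulfK dn0) e; field.
by apply: cubic_ext; apply: divE d0 _; rewrite /det; ring.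
Qed.

(** The coordinates of [v] in a lattice basis are traces against scaled vector products. These lie
    in [dual M], so the coordinates of a bidual vector are integral. *)
Lemma dualK M : lattice M -> dual (dual M) = M.
Proof.
move=> Ml; rewrite eqEsubset; split=> v; last first.
  by move=> Mv w; rewrite mulrC; apply.
move=> ddv; have [e1 [e2 [e3 [[M1 M2 M3] d0 coord]]]] := lattice_basis Ml.
have [[_ MD MZ] _ _] := Ml; rewrite (cramer v d0).
have in_dual u w : (forall v, M v -> ge 0 (det v u w / det e1 e2 e3)) ->
    ge 0 (det v u w / det e1 e2 e3).
  move=> h; rewrite -tr_cross mulrC; apply: ddv => x Mx.
  by rewrite tr_cross; apply: h.
by apply: (MD); first apply: (MD); apply: (MZ) => //; apply: in_dual => x /coord[].
Qed.

Lemma sumsM_omodule I J : omodule ord I -> omodule ord (sums *%R I J).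
Proof.
move=> [I0 ID IZ]; split; [exact: sums0|by move=> x y; apply: sumsD|move=> k v ok].
move: v; apply: (sums_ind (P := fun v : V => sums *%R I J (k *: v))).
- by rewrite scaler0; apply: sums0.
- by move=> *; rewrite scalerDr; apply: sumsD.
- by move=> x y Ix Jy; rewrite scalerAl; apply: sums_act => //; apply: IZ.
Qed.

Lemma sumsM_bounded I J : bounded I -> bounded J -> bounded (sums *%R I J).
Proof.
have [m0 mD _] := max_omodule.
move=> [m Im] [n Jn]; exists (m + n)%N.
apply: (sums_ind (P := fun v : V => max_order ord (pi ^+ (m + n) *: v))).
- by rewrite scaler0.
- by move=> *; rewrite scalerDr; apply: mD.
- move=> x y Ix Jy; rewrite exprD -scalerA scalerAr scalerAl.
  by apply: maxM; [apply: Im|apply: Jn].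
Qed.

Lemma sumsM_lattice I J : lattice I -> lattice J -> lattice (sums *%R I J).
Proof.
move=> [Io Ib [m mI]] [Jo Jb [n nJ]]; split.
- exact: sumsM_omodule.
- exact: sumsM_bounded.
- exists (m + n)%N => v vmax.
  have -> : pi ^+ (m + n) *: v = (pi ^+ m *: 1) * (pi ^+ n *: v).
    by rewrite -scalerAl mul1r scalerA exprD.
  apply: sums_act; last exact: nJ.
  by apply: mI; apply/max_orderP; split; apply: ge1.
Qed.

Lemma is_order_lattice O : is_order ord O -> lattice O.
Proof.
move=> Oo; split; first exact: is_order_omodule.
  by exists 0%N => v Ov; rewrite scale1r; apply: is_order_max Ov.
by apply: spans_cofinite; [apply: is_order_omodule|case: Oo].
Qed.

Lemma fractional_lattice O I : is_order ord O -> fractional_ideal O I ->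
  lattice I /\ forall x y : V, O x -> I y -> I (x * y).
Proof.
move=> Oo [[s ->] Is]; have [_ _ OM _ _ _] := Oo.
split; last first.
  move=> x y Ox; move: y; apply: (sums_ind (P := fun y : V => sums *%R O [set` s] (x * y))).
  - by rewrite mulr0; apply: sums0.
  - by move=> *; rewrite mulrDr; apply: sumsD.
  - by move=> u v Ou sv; rewrite mulrA; apply: sums_act => //; apply: OM.
have so : omodule ord (sums *%R O [set` s]).
  by apply: sumsM_omodule; apply: is_order_omodule.
split=> //; last exact: spans_cofinite.
apply: sumsM_bounded; first by have [] := is_order_lattice Oo.
by have [n sn] := max_clear_seq s; exists n.
Qed.

(** The vectors from [lattice_basis] generate [I] with integral coefficients, which act as diagonal
    elements of [O]. *)
Lemma lattice_fractional O I : is_order ord O -> lattice I ->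
  (forall x y : V, O x -> I y -> I (x * y)) -> fractional_ideal O I.
Proof.
move=> Oo Il OI; have [[I0 ID IZ] _ Ic] := Il; split; last exact: cofinite_spans.
have [e1 [e2 [e3 [[I1 I2 I3] d0 coord]]]] := lattice_basis Il.
exists [:: e1; e2; e3]; rewrite eqEsubset; split=> v.
  move=> Iv; have [c1 c2 c3] := coord v Iv; rewrite (cramer v d0).
  have act k e : oF k -> e \in [:: e1; e2; e3] ->
      sums *%R O [set` [:: e1; e2; e3]] (k *: e).
    have [_ _ _ Oi _ _] := Oo.
    by move=> ok ein; rewrite -mulr_algl; apply: sums_act => //; apply: Oi.
  by apply: sumsD; first apply: sumsD; apply: act; rewrite ?inE ?eqxx ?orbT.
move: v; apply: sums_ind => // x y Ox.
by rewrite /= !inE => /or3P[] /eqP->; apply: OI.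
Qed.

Lemma dual_stable O I : (forall x y : V, O x -> I y -> I (x * y)) ->
  forall x y : V, O x -> dual I y -> dual I (x * y).
Proof. by move=> OI x y Ox Iy u Iu; rewrite mulrA [u * x]mulrC; apply/Iy/OI. Qed.

Lemma dual_sumsM I J v :
  dual (sums *%R I J) v <-> forall x y : V, I x -> J y -> ge 0 (tr (x * y * v)).
Proof.
split=> [dv x y Ix Jy|h u]; first by apply: dv; apply: sums_act.
move: u; apply: (sums_ind (P := fun u : V => ge 0 (tr (u * v)))) => [|u w hu hw|x y].
- by rewrite mul0r /tr /= !addr0; apply: ge0.
- by rewrite mulrDl trD; apply: geD.
- exact: h.
Qed.

(** The set is [t' M], written as a preimage; the denominators of [t] and [t'] shift the two
    bounds. *)
Lemma translate_lattice M (t t' : V) : t * t' = 1 -> lattice M ->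
  lattice [set v | M (t * v)].
Proof.
move=> tt [[M0 MD MZ] [m Mm] [n nM]].
have [k tk] := max_clear t; have [l tl] := max_clear t'.
split; first split=> [|v w|a v oa] /=.
- by rewrite mulr0.
- by rewrite mulrDr; apply: MD.
- by rewrite -scalerAr; apply: MZ.
- exists (l + m)%N => v /= /Mm vm.
  have -> : pi ^+ (l + m) *: v = (pi ^+ l *: t') * (pi ^+ m *: (t * v)).
    by rewrite -scalerAl -scalerAr scalerA -exprD mulrA [t' * t]mulrC tt mul1r.
  exact: maxM.
- exists (n + k)%N => v vmax /=.
  by rewrite -scalerAr exprD -scalerA scalerAl; apply/nM/maxM.
Qed.

(* Duality gives I I^v = (I : I)^v, which is O^v = t O when (I : I) = O. *)
Lemma gorenstein_principal_dual O (t t' : V) : is_order ord O -> t * t' = 1 ->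
  dual O t -> (forall v, dual O v -> O (t' * v)) -> gorenstein O.
Proof.
move=> Oo tt dt dO I fI II; have [Il OI] := fractional_lattice Oo fI.
have Dl := dual_lattice Il; have OD := dual_stable OI.
have IDl := sumsM_lattice Il Dl.
(* A vector [v] is dual to the product exactly when [v I] lies in the bidual of [I], that is in [I];
   dualizing once more gives the equality. *)
have IDE : sums *%R I (dual I) = dual O.
  rewrite -(dualK IDl); congr dual; rewrite -II eqEsubset; split=> v.
    move=> /dual_sumsM dv x Ix; rewrite -(dualK Il) => w Iw.
    by rewrite mulrCA mulrC [w * x]mulrC; apply: dv.
  move=> /= vI; apply/dual_sumsM => x w Ix Iw.
  by rewrite mulrC mulrA; apply/Iw/vI.
(* The inverse is [t'] times [dual I]: its product with [I] is [t'] times [dual O], which is [O]. *)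
exists [set v | dual I (t * v)].
  apply: lattice_fractional => //; first exact: translate_lattice tt Dl.
  by move=> x y Ox /= Iy; rewrite mulrCA; apply: OD.
rewrite eqEsubset; split.
  have [O0 OaddD _] := is_order_omodule Oo.
  apply: sums_ind => // x y Ix /= Iy.
  rewrite -[x * y]mul1r -tt [t * t']mulrC -mulrA [t * (x * y)]mulrCA; apply: dO.
  by rewrite -IDE; apply: sums_act.
move=> u Ou.
have : dual O (t * u) by rewrite mulrC; apply: dual_stable Ou dt; case: Oo.
rewrite -IDE -[X in _ -> sums _ _ _ X]mul1r -tt [t * t']mulrC -mulrA.
move: (t * u); apply: (sums_ind (P := fun w : V => sums *%R I _ (t' * w))).
- by rewrite mulr0; apply: sums0.
- by move=> *; rewrite mulrDr; apply: sumsD.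
- move=> x y Ix Iy; rewrite mulrCA; apply: sums_act => //=.
  by rewrite mulrA tt mul1r.
Qed.

(** The multiplier ring of [dual O] is [O]: if [v] preserves [dual O], evaluating [v w] at [1] for
    [w] in [dual O] puts [v] in the bidual. *)
Lemma gorenstein_dual_invertible O : is_order ord O -> gorenstein O ->
  invertible_ideal O (dual O).
Proof.
move=> Oo; have Ol := is_order_lattice Oo; have [O1 _ OM _ _ _] := Oo.
have OD := dual_stable OM.
apply; first by apply: lattice_fractional => //; apply: dual_lattice.
rewrite eqEsubset; split=> v; last by move=> Ov w; apply: OD.
move=> vD; rewrite -(dualK Ol) => w /vD /(_ 1 O1).
by rewrite mul1r mulrC.
Qed.

(** * The Gorenstein property *)

(* With (1,0,0), these two vectors form the basis of the dual of Oabc a b c for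
   the form (v, w) |-> tr (v * w), dual to its defining generators. *)
Definition dual_b (b : nat) : V := (- (pi ^+ b)^-1, 0, (pi ^+ b)^-1).
Definition dual_a (a b : nat) c : V :=
  ((c - pi ^+ b) / (pi ^+ a * pi ^+ b), (pi ^+ a)^-1, - c / (pi ^+ a * pi ^+ b)).

Lemma piX_neq0 (n : nat) : pi ^+ n != 0.
Proof. by rewrite expf_neq0 // pi_neq0. Qed.

Lemma dual_b_in a b c : dual (O_ a b c) (dual_b b).
Proof.
move=> v; rewrite OabcE => -[_ v2 _]; rewrite /tr /= mulr0 addr0 mulrN addrC.
by rewrite -mulrBl; apply: ge_divX.
Qed.

Lemma dual_a_in a b c : dual (O_ a b c) (dual_a a b c).
Proof.
move=> v; rewrite OabcE => -[_ _ v3]; rewrite /tr /=.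
rewrite [X in ge _ X](_ : _ =
  (v.1.2 - v.1.1 - c * ((v.2 - v.1.1) / pi ^+ b)) / pi ^+ a); first exact: ge_divX.
by field; rewrite !piX_neq0.
Qed.

(** The coefficients are the traces of [w] against the three defining generators, hence integral. *)
Lemma dual_Oabc a b c w : dual (O_ a b c) w ->
  exists k l m : F, [/\ oF k, oF l, oF m &
    w = k *: ((1, 0, 0) : V) + l *: dual_a a b c + m *: dual_b b].
Proof.
have gen : forall g : V, g \in ([:: (1, 1, 1); (0, pi ^+ a, 0); (0, c, pi ^+ b)] : seq V)
    -> O_ a b c g.
  by move=> g gin; rewrite -[g]scale1r; apply: sums_act => //; apply: ge1.
move=> dw.
have := dw _ (gen (1, 1, 1) (mem_head _ _)); rewrite /tr /= !mul1r => w1.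
have := dw (0, pi ^+ a, 0) (gen _ _); rewrite !inE eqxx orbT => /(_ isT).
rewrite /tr /= !mul0r add0r addr0 => w2.
have := dw (0, c, pi ^+ b) (gen _ _); rewrite !inE eqxx !orbT => /(_ isT).
rewrite /tr /= !mul0r add0r => w3.
exists (w.1.1 + w.1.2 + w.2), (pi ^+ a * w.1.2), (c * w.1.2 + pi ^+ b * w.2).
split=> //; apply: cubic_ext; rewrite /= /GRing.scale /=;
  by field; rewrite ?piX_neq0.
Qed.

Lemma gorenstein_generator a b c (t t' : V) :
  is_order ord (O_ a b c) -> t * t' = 1 -> dual (O_ a b c) t ->
  O_ a b c (t' * (1, 0, 0)) -> O_ a b c (t' * dual_a a b c) ->
  O_ a b c (t' * dual_b b) -> gorenstein (O_ a b c).
Proof.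
move=> Oo tt dt O1 O2 O3; apply: (gorenstein_principal_dual Oo tt dt) => w.
move=> /dual_Oabc[k [l [m [ok ol om ->]]]].
have [_ OD OZ] := is_order_omodule Oo.
by rewrite !mulrDr -!scalerAr; apply: (OD); first apply: (OD); apply: (OZ).
Qed.

Lemma Oabc_mem (a b : nat) c (x y z : F) : ge 0 x -> ge 0 z ->
  ge a (y - x - c * z) -> O_ a b c (x, y, x + pi ^+ b * z).
Proof.
move=> x0 z0 yz; rewrite OabcE; split=> //=; rewrite [x + _]addrC addrK.
  exact: ge_0_nat.
by rewrite [pi ^+ b * z]mulrC mulfK // piX_neq0.
Qed.

(** Here [dual_a] generates the dual: equality makes [pi^a / (c (c - pi^b))] integral, so the
    inverse of [dual_a] carries the other two dual basis vectors into the order. *)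
Lemma gorenstein_sum a b c : is_order ord (O_ a b c) -> oF c ->
  (ord c + ord (c - pi ^+ b)%R)%E = a%:Z%:E -> gorenstein (O_ a b c).
Proof.
move=> Oo oc cda.
have od : ge 0 (c - pi ^+ b) by apply: geB oc _; apply: ge_trans (geX b).
have E := piX_neq0.
have c0 : c != 0.
  apply/eqP => c0; move: cda od; rewrite /ge c0 (ord_zero ord_val).
  by case: (ord (0 - _)).
have d0 : c - pi ^+ b != 0.
  apply/eqP => d0; move: cda oc; rewrite /integers /= d0 (ord_zero ord_val).
  by case: (ord c).
have cdE : ord (c * (c - pi ^+ b)) = a%:Z%:E by rewrite (ord_mul ord_val).
have u0 : ge 0 (pi ^+ a / (c * (c - pi ^+ b))) by apply: ge_div cdE (geX a).
have ad : ge 0 (pi ^+ a / (c - pi ^+ b)).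
  rewrite [X in ge _ X](_ : _ = c * (pi ^+ a / (c * (c - pi ^+ b)))); first exact: geMl.
  by field; rewrite c0 d0.
have tt : dual_a a b c *
    ((pi ^+ a * pi ^+ b / (c - pi ^+ b), pi ^+ a, - (pi ^+ a * pi ^+ b) / c) : V) = 1.
  by apply: cubic_ext => /=; field; rewrite ?c0 ?d0 ?E.
apply: (gorenstein_generator Oo tt (@dual_a_in a b c)).
- rewrite [X in O_ a b c X](_ : _ = (pi ^+ b * (pi ^+ a / (c - pi ^+ b)), 0,
    pi ^+ b * (pi ^+ a / (c - pi ^+ b)) + pi ^+ b * - (pi ^+ a / (c - pi ^+ b)))).
    apply: Oabc_mem; [|exact: geN|].
      by apply: geMl => //; apply: ge_trans (geX b).
    rewrite [X in ge _ X](_ : _ = pi ^+ a); first exact: geX.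
    by field.
  by apply: cubic_ext => /=; field; rewrite ?c0 ?d0.
- by rewrite mulrC tt; apply: Oabc_one.
- rewrite [X in O_ a b c X](_ : _ = (- (pi ^+ a / (c - pi ^+ b)), 0,
    - (pi ^+ a / (c - pi ^+ b)) + pi ^+ b * (pi ^+ a / (c * (c - pi ^+ b))))).
    apply: Oabc_mem => //; first exact: geN.
    rewrite [X in ge _ X](_ : _ = 0); first exact: ge0.
    by field; rewrite c0 d0.
  by apply: cubic_ext => /=; field; rewrite ?c0 ?d0 ?E.
Qed.

(** The middle factor splits off. The generator is [dual_b] plus the middle unit vector. *)
Lemma gorenstein_a0 b c : oF c -> is_order ord (O_ 0 b c) -> gorenstein (O_ 0 b c).
Proof.
move=> oc Oo; have E := piX_neq0.
have tt : ((- (pi ^+ b)^-1, 1, (pi ^+ b)^-1) : V) * ((- pi ^+ b, 1, pi ^+ b) : V) = 1.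
  by apply: cubic_ext => /=; field; rewrite ?E ?oner_eq0.
have ob : ge 0 (pi ^+ b) by apply: ge_trans (geX b).
apply: (gorenstein_generator Oo tt).
- move=> v Ov; have /max_orderP[v1 v2 v3] := Oabc_max oc Ov.
  move: Ov; rewrite OabcE => -[_ v13 _].
  rewrite [X in ge _ X](_ : _ = v.1.2 + (v.2 - v.1.1) / pi ^+ b).
    by apply: geD => //; apply: ge_divX.
  by rewrite /tr /=; ring.
- rewrite [X in O_ _ _ _ X](_ : _ = (- pi ^+ b, 0, - pi ^+ b + pi ^+ b * 1)).
    apply: Oabc_mem; [exact: geN|exact: ge1|].
    by rewrite sub0r opprK mulr1; apply: geB.
  by apply: cubic_ext => /=; field; rewrite ?E ?oner_eq0.
- rewrite [X in O_ _ _ _ X](_ : _ = (pi ^+ b - c, 1, (pi ^+ b - c) + pi ^+ b * (-1))).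
    apply: Oabc_mem; [exact: geB|exact/geN/ge1|].
    apply: geB; last by apply: geMl => //; apply/geN/ge1.
    by apply: geB; [apply: ge1|apply: geB].
  by apply: cubic_ext => /=; field; rewrite ?E ?oner_eq0.
- rewrite [X in O_ _ _ _ X](_ : _ = (1, 0, 1 + pi ^+ b * 0)).
    apply: Oabc_mem; [exact: ge1|exact: ge0|].
    by apply: geB; [apply: geB; [apply: ge0|apply: ge1]|rewrite mulr0; apply: ge0].
  by apply: cubic_ext => /=; field; rewrite ?E ?oner_eq0.
Qed.

(** The last factor splits off, leaving the congruence of the first two entries modulo [pi^a]; [t]
    combines generators of the two duals. *)
Lemma gorenstein_b0 a c : oF c -> is_order ord (O_ a 0 c) -> ge a c ->
  gorenstein (O_ a 0 c).
Proof.
move=> oc Oo ac; have E := piX_neq0.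
have tt : ((- (pi ^+ a)^-1, (pi ^+ a)^-1, 1) : V) * ((- pi ^+ a, pi ^+ a, 1) : V) = 1.
  by apply: cubic_ext => /=; field; rewrite ?E ?oner_eq0.
have oa : ge 0 (pi ^+ a) by apply: ge_trans (geX a).
have aa := geX a.
apply: (gorenstein_generator Oo tt).
- move=> v Ov; have /max_orderP[v1 v2 v3] := Oabc_max oc Ov.
  move: Ov; rewrite OabcE => -[_ _ v12].
  rewrite [X in ge _ X](_ : _ = (v.1.2 - v.1.1 - c * ((v.2 - v.1.1) / pi ^+ 0)
    + c * (v.2 - v.1.1)) / pi ^+ a + v.2).
    apply: geD => //; apply: ge_divX; apply: geD => //.
    by apply: geMr => //; apply: geB.
  by rewrite /tr /=; field; rewrite ?E ?oner_eq0.
- rewrite [X in O_ _ _ _ X](_ : _ = (- pi ^+ a, 0, - pi ^+ a + pi ^+ 0 * pi ^+ a)).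
    apply: Oabc_mem => //; first exact: geN.
    by rewrite sub0r opprK; apply: geB => //; apply: geMl.
  by apply: cubic_ext => /=; field; rewrite ?E ?oner_eq0.
- rewrite [X in O_ _ _ _ X](_ : _ = (1 - c, 1, (1 - c) + pi ^+ 0 * (- (c / pi ^+ a) - 1 + c))).
    have oz : ge 0 (- (c / pi ^+ a) - 1 + c).
      apply: geD => //; apply: geB; last exact: ge1.
      by apply: geN; apply: ge_divX.
    apply: Oabc_mem => //; first by apply: geB => //; apply: ge1.
    by rewrite subKr; apply: geB => //; apply: geMr.
  by apply: cubic_ext => /=; field; rewrite ?E ?oner_eq0.
- rewrite [X in O_ _ _ _ X](_ : _ = (pi ^+ a, 0, pi ^+ a + pi ^+ 0 * (1 - pi ^+ a))).
    have oz : ge 0 (1 - pi ^+ a) by apply: geB => //; apply: ge1.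
    apply: Oabc_mem => //; rewrite sub0r.
    by apply: geB; [apply: geN|apply: geMr].
  by apply: cubic_ext => /=; field; rewrite ?E ?oner_eq0.
Qed.

(** Now the first factor splits off, since the last two entries are congruent modulo [pi^a]. *)
Lemma gorenstein_b0_c1 a c : oF c -> is_order ord (O_ a 0 c) -> ge a (c - 1) ->
  gorenstein (O_ a 0 c).
Proof.
move=> oc Oo ac; have E := piX_neq0.
have tt : ((1, (pi ^+ a)^-1, - (pi ^+ a)^-1) : V) * ((1, pi ^+ a, - pi ^+ a) : V) = 1.
  by apply: cubic_ext => /=; field; rewrite ?E ?oner_eq0.
have oa : ge 0 (pi ^+ a) by apply: ge_trans (geX a).
have aa := geX a.
have ac' : ge a (1 - c) by rewrite -opprB; apply: geN.
apply: (gorenstein_generator Oo tt).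
- move=> v Ov; have /max_orderP[v1 v2 v3] := Oabc_max oc Ov.
  move: Ov; rewrite OabcE => -[_ _ v12].
  rewrite [X in ge _ X](_ : _ = (v.1.2 - v.1.1 - c * ((v.2 - v.1.1) / pi ^+ 0)
    + (c - 1) * (v.2 - v.1.1)) / pi ^+ a + v.1.1).
    apply: geD => //; apply: ge_divX; apply: geD => //.
    by apply: geMr => //; apply: geB.
  by rewrite /tr /=; field; rewrite ?E ?oner_eq0.
- rewrite [X in O_ _ _ _ X](_ : _ = (1, 0, 1 + pi ^+ 0 * (-1))).
    apply: Oabc_mem; [exact: ge1|exact/geN/ge1|].
    by rewrite sub0r mulrN1 opprK addrC.
  by apply: cubic_ext => /=; field; rewrite ?E ?oner_eq0.
- pose d := (c - 1) / pi ^+ a; have od : ge 0 d by apply: ge_divX.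
  rewrite [X in O_ _ _ _ X](_ : _ = (d, 1, d + pi ^+ 0 * (c - d))).
    apply: Oabc_mem => //; first exact: geB.
    rewrite [X in ge _ X](_ : _ = (1 - c) * (1 + c) + (c - 1) * d); last by ring.
    by apply: geD; apply: geMr => //; apply: geD => //; apply: ge1.
  by apply: cubic_ext; rewrite /d /=; field; rewrite ?E ?oner_eq0.
- rewrite [X in O_ _ _ _ X](_ : _ = (-1, 0, -1 + pi ^+ 0 * (1 - pi ^+ a))).
    apply: Oabc_mem; [exact/geN/ge1|by apply: geB => //; apply: ge1|].
    rewrite [X in ge _ X](_ : _ = (1 - c) + c * pi ^+ a); last by ring.
    by apply: geD => //; apply: geMl.
  by apply: cubic_ext => /=; field; rewrite ?E ?oner_eq0.
Qed.

(* For v in J both dual_a * v and dual_b * v lie in O, and their entries satisfy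
   relations forcing the middle entry of dual_a * v into (pi); hence the middle
   entries of dual O * J all lie in (pi), so 1 is not a sum of such products. *)
Lemma dual_not_invertible a b c : (0 < a)%N -> (0 < b)%N -> ge 1 c ->
  ge a.+1 (c * (c - pi ^+ b)) -> ~ invertible_ideal (O_ a b c) (dual (O_ a b c)).
Proof.
move=> a0 b0 c1 cd [J _ JE]; have E := piX_neq0.
have mid v : J v -> ge 1 (dual_a a b c * v).1.2.
  move=> Jv.
  have: O_ a b c (dual_a a b c * v) by rewrite -JE; apply: sums_act Jv; apply: dual_a_in.
  have: O_ a b c (dual_b b * v) by rewrite -JE; apply: sums_act Jv; apply: dual_b_in.
  rewrite !OabcE => -[/= y1 y31 y21] [/= x1 x31 x21].
  set z := _ / pi ^+ b in y21; have oz : ge 0 z by apply: ge_divX.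
  set r := _ - _ in y21.
  (* As [dual_b] has middle entry [0], [r] is [v1/pi^b - c z]. Eliminating [v1] leaves two terms in
     [(pi)]: one by the strict bound [cd], the other because [c] is in [(pi)]. *)
  have x3 : ge 1 (- c / (pi ^+ a * pi ^+ b) * v.2).
    rewrite [X in ge _ X](_ : _ = c * (c - pi ^+ b) / pi ^+ a * z + c * (r / pi ^+ a)).
      apply: geD; apply: geMr => //; last exact: ge_divX.
      by apply/ge_divXE; apply: ge_trans cd; lia.
    by rewrite /r /z; field; rewrite ?E ?oner_eq0.
  move: x1 x31 x21; set x_1 := _ * v.1.1; set x_3 := _ / _ * v.2 in x3 *.
  set x_2 := _ * v.1.2 => x1 x31 x21.
  (* Positivity of [b] carries divisibility from the last entry to the first; positivity of [a] then
     carries it to the middle one. *)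
  have x_11 : ge 1 x_1.
    by rewrite -(subKr x_3 x_1); apply: geB => //; apply: ge_trans x31; lia.
  rewrite -(subrK (x_1 + c * ((x_3 - x_1) / pi ^+ b)) x_2); apply: geD.
    by rewrite opprD addrA; apply: ge_trans x21; lia.
  by apply: geD => //; apply: geMr => //; apply: ge_divX.
have: ge 1 (1 : V).1.2.
  have: O_ a b c 1 by apply: Oabc_one.
  rewrite -JE; move: (1 : V); apply: (sums_ind (P := fun v : V => ge 1 v.1.2)).
  - exact: ge0.
  - by move=> *; apply: geD.
  - move=> w v /dual_Oabc[k [l [m [ok ol om ->]]]] Jv.
    (* Among the dual basis vectors only [dual_a] has a nonzero middle entry. *)
    rewrite [X in ge _ X](_ : _ = l * (dual_a a b c * v).1.2).
      by apply: geMl => //; apply: mid.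
    by rewrite /= /GRing.scale /=; ring.
by rewrite /ge /= ord1.
Qed.

(** A form of the criterion in which each alternative has an explicit generator of the dual;
    [gorenstein_conditionP] rewrites it. *)
Lemma gorenstein_iff a b c : oF c -> is_order ord (O_ a b c) ->
  gorenstein (O_ a b c) <->
  ((ord c + ord (c - pi ^+ b)%R)%E = a%:Z%:E \/
   ((a%:Z%:E <= ord c)%E /\ (a = 0%N \/ b = 0%N)) \/
   (b = 0%N /\ (a%:Z%:E <= ord (c - pi ^+ b)%R)%E)).
Proof.
move=> oc Oo; split=> [G|]; last first.
  case=> [cda|[[ac [a0|b0]]|[b0 ad]]]; first exact: gorenstein_sum.
  - by move: Oo; rewrite a0; apply: gorenstein_a0.
  - by move: Oo; rewrite b0 => Oo; apply: gorenstein_b0.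
  - by move: Oo ad; rewrite b0 expr0 => Oo ad; apply: gorenstein_b0_c1.
apply: contrapT => num.
have inv := gorenstein_dual_invertible Oo G.
have od : ge 0 (c - pi ^+ b) by apply: geB oc _; apply: ge_trans (geX b).
have /(Oabc_is_order _ _ oc) := Oo; rewrite /ge (ord_mul ord_val) => cda.
(* The order inequality is strict once equality fails. If [a = 0] or [b = 0], one of the split cases
   would hold, and a unit [c] with [b > 0] would force [a = 0]. *)
have [a0 b0 c1 cd] : [/\ (0 < a)%N, (0 < b)%N, ge 1 c &
    ge a.+1 (c * (c - pi ^+ b))].
  rewrite /ge (ord_mul ord_val).
  move: oc od cda num; rewrite /integers /ge /=; case: (ord_cases b c) => -[].
  + move=> + ->; case: (ord c) => // m; rewrite -EFinD !lee_fin lte_fin => mb m0 _ am num.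
    have n1 : m + m <> a by move=> e; apply: num; left; rewrite e.
    have n2 : a%:Z <= m -> a <> 0%N /\ b <> 0%N.
      by move=> h; split=> e; apply: num; right; left; split=> //; [left|right].
    by split; lia.
  + move=> + ->; case: (ord c) => // [m|].
      rewrite -EFinD !lee_fin lte_fin => mb m0 _ am num.
      have n1 : m + b <> a by move=> e; apply: num; left; rewrite e.
      have n2 : a%:Z <= m -> a <> 0%N /\ b <> 0%N.
        by move=> h; split=> e; apply: num; right; left; split=> //; [left|right].
      by split; lia.
    move=> _ _ _ _ num; have n2 : a <> 0%N /\ b <> 0%N.
      by split=> e; apply: num; right; left; split=> //; [left|right].
    by split=> //; lia.
  + move=> ->; rewrite !lee_fin; case: (ord (c - pi ^+ b)) => // [m|].
      rewrite -EFinD !lee_fin => mb _ m0 am num.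
      have n1 : b%:Z + m <> a by move=> e; apply: num; left; rewrite e.
      have n2 : a%:Z <= b%:Z -> a <> 0%N /\ b <> 0%N.
        by move=> h; split=> e; apply: num; right; left; split=> //; [left|right].
      have n3 : a%:Z <= m -> b <> 0%N.
        by move=> h e; apply: num; right; right.
      by split; lia.
    move=> _ _ _ _ num; have n2 : a%:Z <= b%:Z -> a <> 0%N.
      by move=> h e; apply: num; right; left; split=> //; left.
    have n3 : b <> 0%N by move=> e; apply: num; right; right.
    by split=> //; lia.
exact: dual_not_invertible inv.
Qed.

(** For [b = 0] and [a > 0], the alternative [a <= ord (c - 1)] meets [gorenstein_condition] only at
    equality; strict inequality is the added disjunct. *)
Lemma gorenstein_conditionP a b c : oF c -> is_order ord (O_ a b c) ->
  gorenstein (O_ a b c) <-> gorenstein_condition ord pi a b c \/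
    (b = 0%N /\ (a%:Z%:E < ord (c - 1)%R)%E).
Proof.
move=> oc Oo; rewrite (gorenstein_iff oc Oo).
have od : ge 0 (c - pi ^+ b) by apply: geB oc _; apply: ge_trans (geX b).
have /(Oabc_is_order _ _ oc) := Oo; rewrite /ge (ord_mul ord_val) => cda.
have -> : (b = 0%N /\ (a%:Z%:E < ord (c - 1)%R)%E) <->
    (b = 0%N /\ (a%:Z%:E < ord (c - pi ^+ b)%R)%E).
  by split=> -[->]; rewrite expr0.
have -> : gorenstein_condition ord pi a b c <->
  (if (a%:Z%:E <= ord c)%E then a = 0%N \/ b = 0%N
   else ((b.+1%:Z%:E <= ord (c - pi ^+ b)%R)%E /\
         (ord (c - pi ^+ b) = (a%:Z - b%:Z)%:E /\ 0 < a%:Z - b%:Z)) \/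
       (~ (b.+1%:Z%:E <= ord (c - pi ^+ b)%R)%E /\
         ((~~ odd a /\ ord c = (a./2)%:Z%:E /\ (a./2 <= b)%N) \/
          (ord c = (a%:Z - b%:Z)%:E /\ b%:Z < a%:Z - b%:Z)))).
  rewrite /gorenstein_condition; case: ifP => // _; rewrite pi_idealP.
  have -> : [/\ ~~ odd a, ord c = (a./2)%:Z%:E & (a./2 <= b)%N] <->
     (~~ odd a /\ ord c = (a./2)%:Z%:E /\ (a./2 <= b)%N) by split=> [[? ? ?]|[? [? ?]]].
  by [].
(* Equalities of extended integers turn into equalities of integers or [False], which [lia] can
   treat. *)
have inj m n : (m%:E = n%:E) = (m = n) by apply: propext; split=> [[]|->].
have top n : (+oo%E = n%:E) = False by apply: propext.
have := odd_double_half a.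
move: oc od cda; rewrite /integers /ge /=; case: (ord_cases b c) => -[].
- move=> + ->; case: (ord c) => // m; rewrite -EFinD !inj !lee_fin !lte_fin.
  by case: ifP => h; lia.
- move=> + ->; case: (ord c) => // [m|].
    by rewrite -EFinD !inj !lee_fin !lte_fin; case: ifP => h; lia.
  by rewrite !leey !top !lee_fin !lte_fin /=; lia.
- move=> ->; rewrite !inj; case: (ord (c - pi ^+ b)) => // [m|].
    by rewrite -EFinD !inj !lee_fin !lte_fin; case: ifP => h; lia.
  by rewrite !leey !ltry !top !lee_fin; case: ifP => h; lia.
Qed.

End Valuation.

Theorem proposition5p7 (F : fieldType) (ord : F -> \bar int)
    (ord_val : local_field_valuation ord) (pi : F) (ord_pi : ord pi = 1%:E) :
  (* (1) *)
  ((forall O : set (cubic F), is_order ord O ->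
      exists (a b : nat) (c : F),
        [/\ integers ord c, order_condition ord pi a b c & O = Oabc ord pi a b c]) /\
   (forall (a b : nat) (c : F), integers ord c ->
      order_condition ord pi a b c -> is_order ord (Oabc ord pi a b c))) /\
  (* (2) *)
  (forall (a b : nat) (c : F) (a' b' : nat) (c' : F),
     integers ord c -> integers ord c' ->
     is_order ord (Oabc ord pi a b c) -> is_order ord (Oabc ord pi a' b' c') ->
     order_condition ord pi a' b' c' ->
     (Oabc ord pi a b c `<=` Oabc ord pi a' b' c' <->
        [/\ (a' <= a)%N, (b' <= b)%N &
            if (a'%:Z%:E <= ord c)%E
            then pi_ideal ord pi (a'%:Z - (b%:Z - b'%:Z)) c'
            else pi_ideal ord pi (a'%:Z - (b%:Z - b'%:Z))
                   (c' - pi ^ (- (b%:Z - b'%:Z)) * c)]) /\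
     (Oabc ord pi a b c `<=` Oabc ord pi a' b' c' -> (ord c < a'%:Z%:E)%E ->
        ((a' <= 2 * b')%N ->
           ((uphalf a')%:Z%:E <= ord c - (b%:Z - b'%:Z)%:E)%E /\
           (ord c - (b%:Z - b'%:Z)%:E)%E = ord c') /\
        ((2 * b' < a')%N -> (b < a')%N))) /\
  (* (3) *)
  (forall (a b : nat) (c : F) (a' b' : nat) (c' : F),
     integers ord c -> integers ord c' ->
     is_order ord (Oabc ord pi a b c) -> is_order ord (Oabc ord pi a' b' c') ->
     (Oabc ord pi a' b' c' = Oabc ord pi a b c <->
        [/\ a = a', b = b' & pi_ideal ord pi a%:Z (c - c')])) /\
  (* (4) *)
  (forall (a b : nat) (c : F), integers ord c -> is_order ord (Oabc ord pi a b c) ->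
     quotient_length ord (max_order ord) (Oabc ord pi a b c) (a + b) /\
     exists f1 f2 f3 : int,
       [/\ conductor ord (Oabc ord pi a b c) =
             pi_ideal ord pi f1 `*` pi_ideal ord pi f2 `*` pi_ideal ord pi f3,
           [/\ f1%:E = Order.max b%:Z%:E
                         ((a%:Z + b%:Z)%:E - ord (c - pi ^+ b)%R)%E,
               f2 = a%:Z &
               f3%:E = Order.max b%:Z%:E ((a%:Z + b%:Z)%:E - ord c)%E],
           (a%:Z%:E <= ord c)%E -> f1 = (maxn a b)%:Z /\ f3 = b%:Z &
           (ord c < a%:Z%:E)%E ->
             f1%:E = Order.max b%:Z%:E
                       ((a%:Z + b%:Z)%:E - ord (c - pi ^+ b)%R)%E /\
             f3%:E = ((a%:Z + b%:Z)%:E - ord c)%E]) /\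
  (* (5); gorenstein_condition involves ord (c - pi^b), which for b = 0 is not
     invariant under c mod (pi^a), although the order is: the last disjunct adds
     the c with b = 0 whose class mod (pi^a) is that of 1 + pi^a. *)
  (forall (a b : nat) (c : F), integers ord c -> is_order ord (Oabc ord pi a b c) ->
     (gorenstein (Oabc ord pi a b c) <->
        gorenstein_condition ord pi a b c \/
        (b = 0%N /\ (a%:Z%:E < ord (c - 1)%R)%E))).

Proof.
split; first split=> [O Oo|a b c oc].
- have [a [b [c [oc OE]]]] := order_Oabc ord_val ord_pi Oo.
  exists a, b, c; split=> //; apply/order_conditionP => //.
  by apply/(Oabc_is_order ord_val ord_pi) => //; rewrite -OE.
- by move=> /(order_conditionP ord_val ord_pi _ _ oc) /Oabc_is_order; apply.
split=> [a b c a' b' c' oc oc' _ Oo' cond'|].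
  split.
    rewrite (Oabc_subset ord_val ord_pi).
    by split=> -[aa bb cc]; split=> //; apply/ge_subset_cond.
  move=> sub ca; have ordE := Oabc_subset_ord ord_val ord_pi sub ca.
  have /(Oabc_subset ord_val ord_pi)[aa bb _] := sub.
  rewrite -ordE; split=> ab.
    by split=> //; move: cond'; rewrite /order_condition ab => /(pi_idealP ord_val ord_pi).
  (* For [2b' < a'] either bound forces [ord c' >= b'], hence [b <= ord c < a']. *)
  have : ge ord (a'%:Z - b'%:Z) c' \/ ge ord (a'%:Z - b'%:Z) (c' - pi ^+ b').
    move: cond'; rewrite /order_condition leqNgt ab /=.
    case=> [/(pi_idealP ord_val ord_pi)|]; first by left.
    by case=> y /(pi_idealP ord_val ord_pi) yj <-; right; rewrite [_ + y]addrC addrK.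
  move: oc ca ordE; rewrite /ge /integers /=; case: (ord_cases ord_val ord_pi b' c') => -[].
  + move=> + ->; case: (ord c) => [m| |] // + + + ->.
    by rewrite -EFinB !lee_fin !lte_fin; lia.
  + move=> + ->; case: (ord c) => [m| |] // + + + ->.
    by rewrite -EFinB !lee_fin !lte_fin; lia.
  + move=> -> _; case: (ord c) => [m| |] //.
    by rewrite -EFinB !lee_fin !lte_fin => _ + [e]; lia.
split; first by move=> *; apply: Oabc_eq.
split=> a b c oc Oo; last exact: gorenstein_conditionP.
by split; [apply: (Oabc_length ord_val ord_pi)|apply: (Oabc_conductor ord_val ord_pi)].
Qed.
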